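(* For any integer $i\ge2$ and any weak Schur $\sigma$-group $G$ let $$U_{i,G}:=\{[H]\in\mathrm{Sch}\mid H/D_i(H)\cong G/D_i(G)\},$$ where $\cong$ means $\sigma$-isomorphic. Then: (a) The sets $U_{i,G}$ for all $i\ge2$ and all weak Schur $\sigma$-groups $G$ are a basis for a unique topology on $\mathrm{Sch}$. (b) In this topology each set $U_{i,G}$ is open and closed. (c) For all $n\ge0$ the subsets $\mathrm{Sch}_{\le n}$ and $\mathrm{Sch}_n$ are open and closed in $\mathrm{Sch}$. (d) The topology is Hausdorff and totally disconnected.
   Context: Fix a prime $p>2$ and a group $\{1,\sigma\}$ of order $2$. All homomorphisms of pro-$p$-groups are continuous, all subgroups are closed, and ''generated'' means topologically generated. A $\sigma$-pro-$p$-group is a pro-$p$-group $G$ with a continuous action of $\{1,\sigma\}$, written $a\mapsto{}^\sigma a$; $\sigma$-homomorphisms and $\sigma$-isomorphisms are the $\sigma$-equivariant ones. Put $G^-:=\{a\in G\mid {}^\sigma a=a^{-1}\}$. Let $d_G:=\dim_{\mathbb F_p}H^1(G,\mathbb F_p)$ be the minimal number of generators of $G$. Let $D_i(G)$ ($i\ge1$) be the Zassenhaus filtration (dimension subgroups mod $p$): $D_1(G)=G$, and $D_i(G)$ is generated by the $p$-th powers of elements of $D_{\lceil i/p\rceil}(G)$ and all $[D_j(G),D_k(G)]$ with $j+k=i$; in particular $D_2(G)$ is the Frattini subgroup. $F_n$ is the free pro-$p$-group on $x_1,\dots,x_n$, made a $\sigma$-pro-$p$-group by ${}^\sigma x_i=x_i^{-1}$.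 For $r=(r_1,\dots,r_n)\in(F_n^-)^n$ let $N_r$ be the normal subgroup of $F_n$ generated by all conjugates of $r_1,\dots,r_n$, and $G_r:=F_n/N_r$. A weak Schur $\sigma$-group is a $\sigma$-pro-$p$-group $\sigma$-isomorphic to some $G_r$ with $n\ge0$, $r\in(F_n^-)^n$. $\mathrm{Sch}$ is the set of $\sigma$-isomorphism classes $[G]$ of weak Schur $\sigma$-groups, $\mathrm{Sch}_{\le n}:=\{[G]\in\mathrm{Sch}\mid d_G\le n\}$ and $\mathrm{Sch}_n:=\{[G]\in\mathrm{Sch}\mid d_G=n\}$. *)

(* Defs.v *)
From HB Require Import structures.
From mathcomp Require Import all_boot all_order all_algebra.
From mathcomp Require Import all_classical topology.

Set Implicit Arguments.
Unset Strict Implicit.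
Unset Printing Implicit Defensive.

Local Open Scope classical_set_scope.
Local Open Scope group_scope.

HB.mixin Record isTopologicalGroup G & Group G & Topological G := {
  mulg_continuous : continuous (fun xy : G * G => xy.1 * xy.2);
  invg_continuous : continuous (fun x : G => x^-1)
}.

#[short(type="topGroupType")]
HB.structure Definition TopGroup :=
  {G of Group G & Topological G & isTopologicalGroup G}.

(* As {1, sigma} is finite and discrete, a continuous action of it on G is the *)
(* same thing as a continuous involutive automorphism, the action of sigma.    *)
HB.mixin Record hasSigma G & TopGroup G := {
  sigma : G -> G;
  sigmaM : {morph sigma : x y / x * y};
  sigmaK : involutive sigma;
  sigma_continuous : continuous sigma
}.

#[short(type="sigmaGroupType")]
HB.structure Definition SigmaGroup := {G of TopGroup G & hasSigma G}.

Section closed_subgroups.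
Variable G : topGroupType.
Implicit Types (H A B : set G) (x g : G).

Definition subgroup H :=
  [/\ H 1, forall x y, H x -> H y -> H (x * y) & forall x, H x -> H x^-1].

Definition normal_subgroup H := subgroup H /\ forall x g, H x -> H (x ^ g).

Definition closed_gen A : set G :=
  smallest [set H : set G | closed H /\ subgroup H] A.

Lemma closed_gen_closed A : closed (closed_gen A).
Proof. by apply: closed_bigI => H [[]]. Qed.

Lemma closed_gen_subgroup A : subgroup (closed_gen A).
Proof.
split=> [H [[_ []]] //|x y Ax Ay H HA|x Ax H HA].
  by have := Ax _ HA; have := Ay _ HA; case: HA => -[_ [_ HM _] _] Hy Hx; apply: HM.
by have := Ax _ HA; case: HA => -[_ [_ _ HV] _]; apply: HV.
Qed.

Lemma mulg_cts (T : topologicalType) (f h : T -> G) :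
  continuous f -> continuous h -> continuous (fun t => f t * h t).
Proof.
move=> fc hc t; apply: (@continuous2_cvg _ _ _ _ _ _ f h *%g).
- exact: (mulg_continuous (f t, h t)).
- exact: fc.
- exact: hc.
Qed.

Lemma conjg_cts g : continuous (fun x => x ^ g).
Proof.
by apply: mulg_cts => [x|]; [exact: cvg_cst|apply: mulg_cts => x; [exact: cvg_id|exact: cvg_cst]].
Qed.

Lemma hom1 (f : G -> G) : {morph f : x y / x * y} -> f 1 = 1.
Proof. by move=> fM; apply: (@mulgI _ (f 1)); rewrite -fM !mulg1. Qed.

Lemma homV (f : G -> G) :
  {morph f : x y / x * y} -> {morph f : x / x^-1}.
Proof.
move=> fM x; apply: (@mulgI _ (f x)).
by rewrite -fM !mulgV hom1.
Qed.

Lemma closed_gen_morph (f : G -> G) A B :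
  {morph f : x y / x * y} -> continuous f ->
  (forall x, A x -> closed_gen B (f x)) ->
  forall x, closed_gen A x -> closed_gen B (f x).
Proof.
move=> fM fc fAB; have [B1 BM BV] := closed_gen_subgroup B.
apply: (@smallest_sub _ _ _ (f @^-1` closed_gen B)) => //; split.
  by move/continuous_closedP: fc; apply; exact: closed_gen_closed.
split=> [|x y|x] /=; rewrite ?hom1 ?fM ?homV //.
  exact: BM.
exact: BV.
Qed.

End closed_subgroups.

Section zassenhaus_filtration.
Variables (p : nat) (G : topGroupType).

(* (i + p.-1) %/ p is the ceiling of i / p. *)
Definition zassenhaus_step (D : nat -> set G) (i : nat) : set G :=
  if (i <= 1)%N then setT else
  closed_gen
    ([set x ^+ p | x in D ((i + p.-1) %/ p)%N] `|`
     [set z | exists j k x y, [/\ (0 < j)%N, (0 < k)%N & (j + k = i)%N] /\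
                              [/\ D j x, D k y & z = [~ x, y]]]).

(* The strong recursion is unrolled i times, which is enough for the index i:  *)
(* see zassenhausE. The index 0 is not used.                                   *)
Definition zassenhaus (i : nat) : set G :=
  iter i zassenhaus_step (fun=> setT) i.

Lemma zassenhaus_stepE (D D' : nat -> set G) i : (1 < p)%N ->
  (forall j, (0 < j < i)%N -> D j = D' j) ->
  zassenhaus_step D i = zassenhaus_step D' i.
Proof.
move=> p1 DD'; rewrite /zassenhaus_step; case: leqP => // i1.
congr closed_gen; congr (_ `|` _).
  rewrite DD' // divn_gt0 ?(ltnW p1)// ltn_divLR ?(ltnW p1)//.
  case: p p1 => [//|q] q0; rewrite /= mulnS ltn_add2l ltn_Pmull // andbT.
  by rewrite -add1n leq_add2r ltnW.
apply/seteqP; split=> z [j [k [x [y [[j0 k0 jk] [Dx Dy ->]]]]]];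
  exists j, k, x, y; split=> //; split=> //.
- by rewrite -DD' // j0 -jk -[X in (X < _)%N]addn0 ltn_add2l.
- by rewrite -DD' // k0 -jk -[X in (X < _)%N]add0n ltn_add2r.
- by rewrite DD' // j0 -jk -[X in (X < _)%N]addn0 ltn_add2l.
- by rewrite DD' // k0 -jk -[X in (X < _)%N]add0n ltn_add2r.
Qed.

Lemma zassenhaus_iter m i : (1 < p)%N -> (i <= m)%N ->
  iter m zassenhaus_step (fun=> setT) i = zassenhaus i.
Proof.
move=> p1; elim/ltn_ind: i m => i IH [|m im].
  by rewrite leqn0 => /eqP ->.
rewrite /zassenhaus; case: i IH im => [|i] IH im; first by [].
rewrite /=; apply: zassenhaus_stepE => // j /andP[j0 ji].
by rewrite (IH j ji m (leq_trans ji im)) (IH j ji i ji).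
Qed.

Lemma zassenhaus1 : zassenhaus 1 = setT. Proof. by []. Qed.

Lemma zassenhausE i : (1 < p)%N -> (2 <= i)%N ->
  zassenhaus i = closed_gen
    ([set x ^+ p | x in zassenhaus ((i + p.-1) %/ p)%N] `|`
     [set z | exists j k x y, [/\ (0 < j)%N, (0 < k)%N & (j + k = i)%N] /\
                [/\ zassenhaus j x, zassenhaus k y & z = [~ x, y]]]).
Proof.
case: i => // i p1 i2; rewrite {1}/zassenhaus iterS (zassenhaus_stepE (D' := zassenhaus)) //.
  by rewrite /zassenhaus_step leqNgt i2.
by move=> j /andP[j0 ji]; rewrite zassenhaus_iter.
Qed.

Lemma zassenhaus_iter_morph (f : G -> G) m i :
  {morph f : x y / x * y} -> continuous f ->
  forall x, iter m zassenhaus_step (fun=> setT) i x ->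
            iter m zassenhaus_step (fun=> setT) i (f x).
Proof.
move=> fM fc; elim: m i => [//|m IH] i /=; rewrite /zassenhaus_step.
case: leqP => // i1; apply: closed_gen_morph => // z [[x Dx <-]|].
  apply: sub_gen_smallest; left; exists (f x); first exact: IH.
  by elim: p => [|q IHq]; rewrite ?expg0 ?hom1// !expgS fM IHq.
move=> [j [k [x [y [jk [Dx Dy ->]]]]]]; apply: sub_gen_smallest; right.
exists j, k, (f x), (f y); split=> //; split; [exact: IH|exact: IH|].
by rewrite /commg /conjg !(fM, homV fM).
Qed.

Lemma zassenhaus_group i : closed (zassenhaus i) /\ subgroup (zassenhaus i).
Proof.
rewrite /zassenhaus; case: i => [|i]; first by split; [exact: closedT|].
rewrite /= /zassenhaus_step; case: ifP => _; first by split; [exact: closedT|].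
by split; [exact: closed_gen_closed|exact: closed_gen_subgroup].
Qed.

End zassenhaus_filtration.

Record sigmaNormal (G : sigmaGroupType) := SigmaNormal {
  sn_set : set G;
  sn_closed : closed sn_set;
  sn_normal : normal_subgroup sn_set;
  sn_sigma : forall x, sn_set x -> sn_set (sigma x)
}.

Section quotient.
Variables (G : sigmaGroupType) (N : sigmaNormal G).
Implicit Types x y z : G.

Let NM x y : sn_set N x -> sn_set N y -> sn_set N (x * y).
Proof. by case: (sn_normal N) => -[_ + _] _; apply. Qed.
Let NV x : sn_set N x -> sn_set N x^-1.
Proof. by case: (sn_normal N) => -[_ _ +] _; apply. Qed.
Let NJ x g : sn_set N x -> sn_set N (x ^ g).
Proof. by case: (sn_normal N) => _; apply. Qed.

Definition coset (x : G) : G -> Prop := fun y => sn_set N (x^-1 * y).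

(* The type G -> Prop rather than set G keeps the universe of quot that of G,  *)
(* so that quot is again a sigmaGroupType.                                     *)
Definition quot : Type := {C : G -> Prop | exists x, C = coset x}.
HB.instance Definition _ := gen_eqMixin quot.
HB.instance Definition _ := gen_choiceMixin quot.

Definition to_quot (x : G) : quot := exist _ (coset x) (ex_intro _ x erefl).

Lemma to_quotP x y : to_quot x = to_quot y <-> sn_set N (x^-1 * y).
Proof.
split=> [/(congr1 sval) /= xy|xy].
  have : coset y y by rewrite /coset mulVg; case: (sn_normal N) => -[].
  by rewrite -xy.
apply: eq_exist; apply/funext => z; apply/propext; rewrite /coset.
split=> [xz|yz].
  by have := NM (NV xy) xz; rewrite invgM invgK -mulgA mulVKg.
by have := NM xy yz; rewrite -mulgA mulVKg.
Qed.

Lemma to_quot_surj (a : quot) : exists x, a = to_quot x.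
Proof. by case: a => C [x Cx]; exists x; exact: eq_exist. Qed.

Definition rep (a : quot) : G := sval (cid (to_quot_surj a)).

Let repK x : sn_set N ((rep (to_quot x))^-1 * x).
Proof. by apply/to_quotP; rewrite /rep; case: cid => y /= <-. Qed.

Definition quot_open (U : set quot) : Prop := open (to_quot @^-1` U).

Let quot_openT : quot_open setT.
Proof. by rewrite /quot_open preimage_setT; exact: openT. Qed.
Let quot_openI : setI_closed quot_open.
Proof. by move=> U V oU oV; exact: openI. Qed.
Let quot_open_bigU (I : Type) (f : I -> set quot) :
  (forall i, quot_open (f i)) -> quot_open (\bigcup_i f i).
Proof.
by move=> fo; rewrite /quot_open preimage_bigcup; apply: bigcup_open => i _; exact: fo.
Qed.
HB.instance Definition _ := isOpenTopological.Build quot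
  quot_openT quot_openI quot_open_bigU.

Definition quot_mul (a b : quot) : quot := to_quot (rep a * rep b).
Definition quot_inv (a : quot) : quot := to_quot (rep a)^-1.
Definition quot_one : quot := to_quot 1.
Definition quot_sigma (a : quot) : quot := to_quot (sigma (rep a)).

Lemma quot_mulE x y : quot_mul (to_quot x) (to_quot y) = to_quot (x * y).
Proof.
apply/to_quotP; have := NM (NJ (rep (to_quot y)) (repK x)) (repK y).
by rewrite /conjg invgM -!mulgA mulVKg.
Qed.

Lemma quot_invE x : quot_inv (to_quot x) = to_quot x^-1.
Proof.
apply/to_quotP; have := NJ x^-1 (NV (repK x)).
by rewrite /conjg !invgM !invgK -!mulgA mulVKg.
Qed.

Lemma quot_sigmaE x : quot_sigma (to_quot x) = to_quot (sigma x).
Proof.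
apply/to_quotP; have := sn_sigma (repK x).
by rewrite sigmaM (homV (@sigmaM G)).
Qed.

Lemma quot_mulA : associative quot_mul.
Proof.
move=> a b c; have [x ->] := to_quot_surj a; have [y ->] := to_quot_surj b.
by have [z ->] := to_quot_surj c; rewrite !quot_mulE mulgA.
Qed.

Lemma quot_mul1 : left_id quot_one quot_mul.
Proof. by move=> a; have [x ->] := to_quot_surj a; rewrite quot_mulE mul1g. Qed.

Lemma quot_1mul : right_id quot_one quot_mul.
Proof. by move=> a; have [x ->] := to_quot_surj a; rewrite quot_mulE mulg1. Qed.

Lemma quot_mulV : left_inverse quot_one quot_inv quot_mul.
Proof.
by move=> a; have [x ->] := to_quot_surj a; rewrite quot_invE quot_mulE mulVg.
Qed.

Lemma quot_Vmul : right_inverse quot_one quot_inv quot_mul.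
Proof.
by move=> a; have [x ->] := to_quot_surj a; rewrite quot_invE quot_mulE mulgV.
Qed.

HB.instance Definition _ := isGroup.Build quot
  quot_mulA quot_mul1 quot_1mul quot_mulV quot_Vmul.

Lemma to_quotM : {morph to_quot : x y / x * y}.
Proof. by move=> x y; rewrite [RHS]quot_mulE. Qed.

Lemma to_quot_continuous : continuous to_quot.
Proof. exact/continuousP. Qed.

Lemma to_quot_open (A : set G) : open A -> open (to_quot @` A).
Proof.
move=> oA; rewrite /open /= /quot_open.
rewrite (_ : _ @^-1` _ = \bigcup_(n in sn_set N) [set x | A (x * n)]).
  apply: bigcup_open => n _; apply: open_comp => // x _.
  by apply: mulg_cts => {}x; [exact: cvg_id|exact: cvg_cst].
apply/seteqP; split=> [x [a Aa /esym/to_quotP xa]|x [n Nn Axn]].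
  by exists (x^-1 * a) => //=; rewrite mulVKg.
by exists (x * n) => //; apply/esym/to_quotP; rewrite mulKg.
Qed.

Lemma quot_mulg_continuous : continuous (fun ab : quot * quot => ab.1 * ab.2).
Proof.
move=> [a b] U /=; have [x ->] := to_quot_surj a; have [y ->] := to_quot_surj b.
rewrite -to_quotM => /to_quot_continuous xyU.
have {xyU} [[A B] /= [xA yB] AB] := mulg_continuous (x, y) _ xyU.
have onbhs z C : nbhs z C -> nbhs (to_quot z) (to_quot @` C).
  rewrite nbhsE => -[V [oV Vz] VC]; rewrite nbhsE.
  exists (to_quot @` V); last exact: image_subset.
  by split; [exact: to_quot_open|exists z].
exists (to_quot @` A, to_quot @` B); first by split; exact: onbhs.
move=> [_ _] /= [[u Au <-] [v Bv <-]].
by rewrite /preimage /= -to_quotM; exact: (AB (u, v)).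
Qed.

Lemma quot_lift_continuous (f : G -> G) (g : quot -> quot) :
  (forall x, g (to_quot x) = to_quot (f x)) -> continuous f -> continuous g.
Proof.
move=> gf /continuousP fc; apply/continuousP => U oU.
rewrite /open /= /quot_open (_ : _ @^-1` _ = f @^-1` (to_quot @^-1` U)).
  by apply: fc; exact: oU.
by apply/seteqP; split=> x /=; rewrite gf.
Qed.

Lemma quot_invg_continuous : continuous (fun a : quot => a^-1).
Proof. exact: quot_lift_continuous quot_invE (@invg_continuous G). Qed.

HB.instance Definition _ := isTopologicalGroup.Build quot
  quot_mulg_continuous quot_invg_continuous.

Lemma quot_sigmaM : {morph quot_sigma : a b / a * b}.
Proof.
move=> a b; have [x ->] := to_quot_surj a; have [y ->] := to_quot_surj b.
by rewrite -to_quotM !quot_sigmaE -to_quotM sigmaM.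
Qed.

Lemma quot_sigmaK : involutive quot_sigma.
Proof.
by move=> a; have [x ->] := to_quot_surj a; rewrite !quot_sigmaE sigmaK.
Qed.

Lemma quot_sigma_continuous : continuous quot_sigma.
Proof. exact: quot_lift_continuous quot_sigmaE (@sigma_continuous G). Qed.

HB.instance Definition _ := hasSigma.Build quot
  quot_sigmaM quot_sigmaK quot_sigma_continuous.

End quotient.

Definition continuous_hom (G H : topGroupType) (f : G -> H) : Prop :=
  {morph f : x y / x * y} /\ continuous f.

Definition sigma_iso (G H : sigmaGroupType) : Prop :=
  exists (f : G -> H) (g : H -> G),
    [/\ cancel f g, cancel g f, continuous_hom f, continuous_hom g &
        {morph f : x / sigma x}].

Definition pro_p (p : nat) (G : topGroupType) : Prop :=
  [/\ compact [set: G], hausdorff_space G, totally_disconnected [set: G] &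
      forall N : set G, open N -> normal_subgroup N ->
        exists k : nat,
          (range (fun g : G => [set g * x | x in N]) #= `I_(p ^ k))%card].

Definition free_pro_p (p n : nat) (F : topGroupType) (x : 'I_n -> F) : Prop :=
  pro_p p F /\
  forall (Q : topGroupType) (y : 'I_n -> Q), pro_p p Q ->
    exists! f : F -> Q, continuous_hom f /\ forall i, f (x i) = y i.

(* G^- *)
Definition minus_part (G : sigmaGroupType) : set G := [set a | sigma a = a^-1].

Section relations.
Variables (n : nat) (F : sigmaGroupType) (r : 'I_n -> F).
Hypothesis rminus : forall i, minus_part (r i).

Definition relator_set : set F :=
  closed_gen [set z | exists i g, z = r i ^ g].

Lemma relator_set_normal : normal_subgroup relator_set.
Proof.
split=> [|x g]; first exact: closed_gen_subgroup.
apply: (@closed_gen_morph _ (fun x => x ^ g)) => {x}.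
- by move=> x y; rewrite conjMg.
- exact: conjg_cts.
by move=> _ [i [h ->]]; apply: sub_gen_smallest; exists i, (h * g); rewrite conjgM.
Qed.

Lemma relator_set_sigma x : relator_set x -> relator_set (sigma x).
Proof.
apply: closed_gen_morph; [exact: sigmaM|exact: sigma_continuous|].
move=> _ [i [h ->]]; have [_ _ NV] := closed_gen_subgroup [set z | exists i g, z = r i ^ g].
have -> : sigma (r i ^ h) = (r i ^ sigma h)^-1.
  rewrite -conjVg -(rminus i) /conjg !sigmaM.
  by rewrite (homV (@sigmaM F)).
by apply: NV; apply: sub_gen_smallest; exists i, (sigma h).
Qed.

Definition relator_group : sigmaNormal F :=
  SigmaNormal (@closed_gen_closed _ _) relator_set_normal relator_set_sigma.
End relations.

Section zassenhaus_quotient.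
Variables (p : nat) (G : sigmaGroupType) (i : nat).

Lemma zassenhaus_closed : closed (zassenhaus p (G := G) i).
Proof. by have [] := zassenhaus_group p G i. Qed.

Lemma zassenhaus_normal : normal_subgroup (zassenhaus p (G := G) i).
Proof.
split=> [|x g]; first by have [] := zassenhaus_group p G i.
apply: (@zassenhaus_iter_morph _ _ (fun x => x ^ g)); last exact: conjg_cts.
by move=> {}x y; rewrite conjMg.
Qed.

Lemma zassenhaus_sigma x : zassenhaus p i x -> zassenhaus p i (sigma x : G).
Proof. exact: zassenhaus_iter_morph (@sigmaM G) (@sigma_continuous G) x. Qed.

Definition zassenhaus_sn : sigmaNormal G :=
  SigmaNormal zassenhaus_closed zassenhaus_normal zassenhaus_sigma.

Definition quot_zassenhaus : sigmaGroupType := quot zassenhaus_sn.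
End zassenhaus_quotient.

(* F with x is F_n: a free pro-p group on the x_i, with sigma x_i = x_i^-1.     *)
Definition weak_schur (p : nat) (G : sigmaGroupType) : Prop :=
  pro_p p G /\
  exists (n : nat) (F : sigmaGroupType) (x r : 'I_n -> F)
         (rminus : forall i, minus_part (r i)),
    [/\ free_pro_p p x, forall i, sigma (x i) = (x i)^-1 &
        sigma_iso G (quot (relator_group rminus))].

(* H^1(G, F_p): for the trivial action on F_p the 1-coboundaries vanish and    *)
(* the continuous 1-cocycles are the continuous homomorphisms to the discrete  *)
(* group F_p.                                                                  *)
Definition H1 (p : nat) (G : topGroupType) : set (G -> 'F_p) :=
  [set f : G -> 'F_p | (forall x y, f (x * y)%g = (f x + f y)%R) /\
                       forall A : set 'F_p, open (f @^-1` A)].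

(* d = dim H^1(G, F_p), the number d_G. *)
Definition dim_H1_is (p : nat) (G : topGroupType) (d : nat) : Prop :=
  exists b : 'I_d -> (G -> 'F_p),
    (forall i, H1 (b i)) /\
    forall f, H1 f -> exists! c : {ffun 'I_d -> 'F_p},
      f = (fun g => \sum_(i < d) c i * b i g)%R.

Definition iso_class (G : sigmaGroupType) : set sigmaGroupType :=
  [set H | sigma_iso G H].

Definition Sch (p : nat) : Type :=
  {C : set sigmaGroupType | exists2 G, weak_schur p G & C = iso_class G}.

(* c = [H] *)
Definition is_class_of (p : nat) (c : Sch p) (H : sigmaGroupType) : Prop :=
  sval c = iso_class H.

Definition Sch_le (p n : nat) : set (Sch p) :=
  [set c | exists H d, [/\ is_class_of c H, dim_H1_is p H d & (d <= n)%N]].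

Definition Sch_eq (p n : nat) : set (Sch p) :=
  [set c | exists2 H, is_class_of c H & dim_H1_is p H n].

Definition U (p i : nat) (G : sigmaGroupType) : set (Sch p) :=
  [set c | exists2 H, is_class_of c H &
                      sigma_iso (quot_zassenhaus p H i) (quot_zassenhaus p G i)].

Definition U_family (p : nat) : set (set (Sch p)) :=
  [set V | exists i G, [/\ (2 <= i)%N, weak_schur p G & V = U i G]].

Arguments Sch_le p n : clear implicits.
Arguments Sch_eq p n : clear implicits.
Arguments U p i G : clear implicits.
Arguments U_family p : clear implicits.

Record topology (T : Type) := Topology {
  opens : set (set T);
  opensT : opens setT;
  opensI : setI_closed opens;
  opens_bigcup : forall F : set (set T), F `<=` opens ->
    opens (\bigcup_(A in F) A)
}.

Definition topologized (T : Type) (tau : topology T) : Type := T.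

Section topologized.
Variables (T : Type) (tau : topology T).
HB.instance Definition _ := gen_eqMixin (topologized tau).
HB.instance Definition _ := gen_choiceMixin (topologized tau).

Let opens_bigU (I : Type) (f : I -> set T) :
  (forall i, opens tau (f i)) -> opens tau (\bigcup_i f i).
Proof.
move=> fo; rewrite -(bigcup_image setT f id).
by apply: opens_bigcup => _ [i _ <-].
Qed.

HB.instance Definition _ := isOpenTopological.Build (topologized tau)
  (opensT tau) (@opensI _ tau) opens_bigU.
End topologized.

(* Main.v *)
Require Import Defs.
From mathcomp Require Import all_boot all_order all_algebra.
From mathcomp Require Import all_fingroup all_solvable.
From mathcomp Require Import all_classical topology.
From mathcomp Require Import zify.

(* U_{i,G} is the class of G for the relation of being isomorphic modulo D_i,
   which gets finer as i grows; hence these sets form a basis and are clopen.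
   The number d_G only depends on G/D_2(G), since homomorphisms to F_p kill
   D_2(G). For (d) it is enough to separate points, that is, to show that G and
   H are isomorphic if G/D_i(G) and H/D_i(H) are for all i. With covers F -> G
   and F' -> H by free groups of ranks n and m, an isomorphism modulo D_i lifts
   to homomorphisms F -> F' and F' -> F, which by the universal property form a
   point of the compact space F'^n x F^m. Being an isomorphism modulo D_i is a
   closed condition on that point, and it gets stronger with i. So a cluster
   point of solutions for all i satisfies all conditions, and it defines an
   isomorphism G -> H because the D_i of a pro-p group intersect trivially. *)

Set Implicit Arguments.
Unset Strict Implicit.
Unset Printing Implicit Defensive.

Local Open Scope classical_set_scope.
Local Open Scope group_scope.

(** * Topological preliminaries *)

(** In a compact Hausdorff space the quasi-component [Q] of [x], the intersection of all clopen sets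
    containing [x], is connected. Total disconnectedness then leaves no room for a second point [y]
    in [Q]. *)
Lemma totally_disconnected_zero_dimensional (T : topologicalType) :
  compact [set: T] -> hausdorff_space T -> totally_disconnected [set: T] ->
  zero_dimensional T.
Proof.
move=> cT hT tT x y xy; apply: contrapT => nU.
pose F := filter_from [set D : set T | D x /\ clopen D] id.
have FF : Filter F.
  apply: filter_from_filter; first by exists setT; split => //; exact: clopenT.
  by move=> A B [? ?] [? ?]; exists (A `&` B) => //; split=> //; exact: clopenI.
have PF : ProperFilter F by apply: filter_from_proper; move=> ? [? _]; exists x.
pose Q : set T := \bigcap_(D in [set D : set T | D x /\ clopen D]) D.
(* By compactness of the complement of [W], finitely many clopen neighbourhoods of [x] already meet
   inside [W]. *)
have FQ (W : set T) : open W -> Q `<=` W -> F W.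
  move=> oW QW.
  have /(iffLR (compact_near_coveringP _)) : compact (~` W).
    by apply: (subclosed_compact _ cT) => //; exact: open_closedC.
  move=> /(_ _ _ setC (powerset_filter_from_filter PF))[].
    move=> z nWz.
    have [C [Cx [oC cC]] nCz] : exists2 C, C x /\ clopen C & ~ C z.
      apply: contrapT => nC; apply/nWz/QW => C [Cx cC].
      by apply: contrapT => nCz; apply: nC; exists C.
    exists (~` C, [set U | U `<=` C]); first split.
    - by apply: open_nbhs_nbhs; split => //; exact: closed_openC.
    - apply/near_powerset_filter_fromP; first by move=> ? ?; exact: subset_trans.
      by exists C => //; exists C.
    - by case=> i j [? /subsetC]; apply.
  by move=> D [DF _ [C DC]]/(_ _ DC)/subsetC2/filterS; apply; exact: DF.
have Qx : Q x by move=> D [].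
have Qy : Q y.
  by move=> D [Dx cD]; apply: contrapT => nDy; apply: nU; exists D.
have cQ : closed Q by apply: closed_bigI => D [_ []].
suff : connected Q.
  move=> coQ; have : connected_component [set: T] x y by exists Q.
  by rewrite tT // => /= yx; rewrite yx eqxx in xy.
apply: contrapT => /connectedPn [E [E0 QE [sE1 sE2]]].
wlog E0x : E E0 QE sE1 sE2 / E false x.
  move=> G; move: (Qx); rewrite {1}QE => -[E0x|E1x]; first exact: (G E).
  apply: (G (E \o negb)) => //=; rewrite ?[_ `|` E false]setUC //.
    by rewrite setIC.
  by rewrite setIC.
have clE b : closed (E b).
  have EQ c : E c `<=` Q by rewrite QE; case: c => z; [right|left].
  rewrite closure_id; apply/seteqP; split; first exact: subset_closure.
  move=> z clz; have : Q z by apply: cQ; apply: closure_subset clz; exact: EQ.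
  rewrite QE; case: b clz => clz [] // Ez.
    by exfalso; rewrite -[False]/(set0 z) -sE2.
  by exfalso; rewrite -[False]/(set0 z) -sE1.
have E01 z : E false z -> E true z -> False.
  by move=> *; rewrite -[False]/(set0 z) -sE1; split => //; exact: subset_closure.
(* By normality the closed piece [E false] has a neighbourhood whose closure misses [E true]. *)
have [U /set_nbhsP [V [oV E0V VU]] clU] :
    filter_from (set_nbhs (E false)) closure (~` E true).
  apply: (compact_normal hT cT (clE false)); apply/set_nbhsP.
  by exists (~` E true); split => //; exact/closed_openC.
(* On [D] the open set [V] and the closed set [closure U] coincide. Hence [D] meets [V] in a clopen
   set containing [x], so this set contains all of [Q], although [E true] lies outside
   [closure U]. *)
have [D [Dx [oD cD]] DW] : F (V `|` ~` closure U).
  apply: FQ; first by apply: openU => //; exact/closed_openC/closed_closure.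
  rewrite QE => z [/E0V|E1z]; [by left|right] => clUz; exact: clU E1z.
have [z Ez] := E0 true.
have : (D `&` V) z; last by move=> [_ /VU/subset_closure/clU].
have Qz : Q z by rewrite QE; right.
apply: Qz; split; first by split => //; exact: E0V.
split; first exact: openI.
rewrite (_ : _ `&` _ = D `&` closure U).
  by apply: closedI => //; exact: closed_closure.
apply/seteqP; split=> w [Dw].
  by move=> /VU/subset_closure.
by case: (DW w Dw).
Qed.

Lemma compact_tube (T U : topologicalType) (K : set T) (u : U) (P : set (T * U)) :
  compact K -> open P -> (forall x, K x -> P (x, u)) ->
  \forall v \near u, forall x, K x -> P (x, v).
Proof.
move=> /compact_near_coveringP cK oP KP.
apply: (cK _ (nbhs u) (fun v x => P (x, v))) => x Kx.
have : nbhs (x, u) P by apply: open_nbhs_nbhs; split=> //; exact: KP.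
by apply: filterS => -[].
Qed.

Lemma hausdorff_closed1 (T : topologicalType) (x : T) :
  hausdorff_space T -> closed [set x].
Proof. by move=> hT; exact: (accessible_closed_set1 (hausdorff_accessible hT)). Qed.

Lemma zero_dimensional_hausdorff (T : topologicalType) :
  zero_dimensional T -> hausdorff_space T.
Proof.
move=> zT; rewrite open_hausdorff => x y /zT[V [[oV cV] Vx nVy]].
exists (V, ~` V); first by rewrite !inE.
by split=> //=; [exact: closed_openC|rewrite setICr].
Qed.

Lemma cluster_closed (T U : topologicalType) (u : nat -> T) (t : T) (h : T -> U)
    (K : set U) i :
  cluster (u @ \oo) t -> continuous h -> closed K ->
  (forall m, (i <= m)%N -> K (h (u m))) -> K (h t).
Proof.
move=> ut /continuous_closedP hc cK Ku.
suff : (h @^-1` K) t by [].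
apply: (hc _ cK) => B Bt; apply: ut => //.
by exists i => // m /= /Ku.
Qed.

Lemma pair_cts (T U V : topologicalType) (f : T -> U) (h : T -> V) (s : T) :
  {for s, continuous f} -> {for s, continuous h} ->
  {for s, continuous (fun t => (f t, h t))}.
Proof. by move=> fs hs; exact: cvg_pair. Qed.

Lemma compact_ptws n (E : topologicalType) :
  compact [set: E] -> compact [set: {ptws 'I_n -> E}].
Proof.
move=> cE; have := tychonoff (fun _ : 'I_n => cE).
by congr compact; apply/seteqP; split.
Qed.

(** * Homomorphisms and generated closed subgroups *)

Section group_morphisms.
Variables (G H : groupType) (f : G -> H).
Hypothesis fM : {morph f : x y / x * y}.

Lemma mulg_morph1 : f 1 = 1.
Proof. by apply: (@mulgI _ (f 1)); rewrite -fM !mulg1. Qed.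

Lemma mulg_morphV : {morph f : x / x^-1}.
Proof. by move=> x; apply: (@mulgI _ (f x)); rewrite -fM !mulgV mulg_morph1. Qed.

Lemma mulg_morphX n : {morph f : x / x ^+ n}.
Proof. by move=> x; elim: n => [|n IH]; rewrite ?expg0 ?mulg_morph1 // !expgS fM IH. Qed.

Lemma mulg_morphJ : {morph f : x y / x ^ y}.
Proof. by move=> x y; rewrite /conjg !fM mulg_morphV. Qed.

Lemma mulg_morphR : {morph f : x y / [~ x, y]}.
Proof. by move=> x y; rewrite /commg /conjg !(fM, mulg_morphV). Qed.

End group_morphisms.

Lemma closed_gen_min (G : topGroupType) (A K : set G) :
  closed K -> subgroup K -> A `<=` K -> closed_gen A `<=` K.
Proof. by move=> cK sK; apply: smallest_sub. Qed.

Lemma preimage_subgroup (G H : topGroupType) (f : G -> H) (K : set H) :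
  {morph f : x y / x * y} -> subgroup K -> subgroup (f @^-1` K).
Proof.
move=> fM [K1 KM KV]; split=> [|x y|x] /=; rewrite ?(mulg_morph1 fM) //.
  by rewrite fM; exact: KM.
by rewrite (mulg_morphV fM); exact: KV.
Qed.

(** * Finite quotients of pro-p groups *)

Section topological_groups.
Variable G : topGroupType.
Implicit Types (N K : set G).

Lemma lmulg_cts (g : G) : continuous (fun x => g * x).
Proof. by apply: mulg_cts => x; [exact: cvg_cst|exact: cvg_id]. Qed.

Lemma open_lcoset N g : open N -> open [set x : G | N (g * x)].
Proof. by move=> oN; apply: open_comp oN => x _; exact: lmulg_cts. Qed.

Lemma open_subgroup N : subgroup N -> nbhs (1 : G) N -> open N.
Proof.
move=> [N1 NM NV] nN; rewrite openE => x Nx; rewrite /interior.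
have nx : nbhs x [set z | N (x^-1 * z)] by apply: lmulg_cts; rewrite mulVg.
by apply: filterS nx => z /= /(NM _ _ Nx); rewrite mulVKg.
Qed.

Lemma subgroup_closed N : subgroup N -> open N -> closed N.
Proof.
move=> [N1 NM NV] oN; rewrite -openC.
rewrite (_ : ~` N = \bigcup_(g in ~` N) [set x | N (g^-1 * x)]).
  by apply: bigcup_open => g _; exact: open_lcoset.
apply/seteqP; split=> [g Ng|x [g Ng Ngx] Nx]; first by exists g => //=; rewrite mulVg.
by have := NV _ (NM _ _ Ngx (NV _ Nx)); rewrite mulgK invgK.
Qed.

End topological_groups.

Section open_normal_basis.
Variable G : topGroupType.
Hypotheses (cG : compact [set: G]) (hG : hausdorff_space G).
Hypothesis tG : totally_disconnected [set: G].

(** Shrink [V] to a clopen neighbourhood [W] of 1, and take the elements all of whose conjugates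
    stabilise [W] under right multiplication. They lie in [W] because [W] contains 1; openness comes
    from compactness of [G]. *)
Lemma open_normal_basis (V : set G) : nbhs (1 : G) V ->
  exists N, [/\ open N, normal_subgroup N & N `<=` V].
Proof.
move=> nV.
have zG := totally_disconnected_zero_dimensional cG hG tG.
have [W [W1 [oW cW]] WV] := zero_dimensional_cvg hG zG cG nV.
pose N := [set g : G | forall h v, W v <-> W (v * g ^ h)].
have sN : subgroup N.
  split=> [h v|x y Nx Ny h v|x Nx h v]; first by rewrite conj1g mulg1.
    by rewrite conjMg mulgA (Nx h v) (Ny h).
  by rewrite (Nx h (v * _)) conjVg mulgVK.
pose c (a : (G * G) * G) := a.1.2 * a.2 ^ a.1.1.
have c12 : continuous (fun a : (G * G) * G => a.1.2).
  by move=> a; apply: continuous_comp; [exact: cvg_fst|exact: cvg_snd].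
have c11 : continuous (fun a : (G * G) * G => a.1.1).
  by move=> a; apply: continuous_comp; exact: cvg_fst.
have c2 : continuous (fun a : (G * G) * G => a.2) by move=> a; exact: cvg_snd.
have cc : continuous c.
  apply: mulg_cts c12 (mulg_cts _ (mulg_cts c2 c11)) => a.
  exact: (continuous_comp (c11 a) (@invg_continuous G _)).
have oW' : open (~` W) by exact: closed_openC.
exists N; split.
- apply: open_subgroup => //.
  (* [P] consists of the ((h, v), g) satisfying the condition that defines [N]. It is open since [W]
     is clopen, and it contains all ((h, v), 1), so the tube lemma over the compact space of pairs
     (h, v) yields a neighbourhood of 1 inside [N]. *)
  pose P : set ((G * G) * G) := [set a | W a.1.2 <-> W (c a)].
  have oP : open P.
    rewrite (_ : P = ((fun a => a.1.2) @^-1` W `&` c @^-1` W) `|`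
                     ((fun a => a.1.2) @^-1` (~` W) `&` c @^-1` (~` W))).
      by apply: openU; apply: openI; [move: c12|move: cc|move: c12|move: cc] => /continuousP; apply.
    apply/seteqP; split=> a; rewrite /P /=; last by tauto.
    by case: (pselect (W a.1.2)); tauto.
  have /(compact_tube (compact_setX cG cG) oP) :
      forall hv, ([set: G] `*` [set: G]) hv -> P (hv, 1).
    by move=> [h v] _; rewrite /P /c /= conj1g mulg1.
  by apply: filterS => g PW h v; exact: (PW (h, v)).
- split=> // x g Nx h v; rewrite -conjgM; exact: Nx.
- by move=> g /(_ 1 1); rewrite mul1g conjg1 => -[+ _] => /(_ W1)/WV.
Qed.
End open_normal_basis.

Lemma lcoset_eqP (G : topGroupType) (N : set G) (x y : G) : subgroup N ->
  [set x * z | z in N] = [set y * z | z in N] <-> N (x^-1 * y).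
Proof.
move=> [N1 NM NV]; split=> [xy|Nxy].
  have : [set y * z | z in N] y by exists 1; rewrite ?mulg1.
  by rewrite -xy => -[z Nz <-]; rewrite mulKg.
apply/seteqP; split=> _ [z Nz <-].
  exists ((x^-1 * y)^-1 * z); first by apply: NM => //; exact: NV.
  by rewrite invgM invgK !mulgA mulgV mul1g.
by exists (x^-1 * y * z); [exact: NM|rewrite !mulgA mulgV mul1g].
Qed.

(* The finite quotient G / N is realised by the regular permutation            *)
(* representation of G on the cosets of N.                                     *)
Lemma pro_p_finite_quotient p (G : topGroupType) (N : set G) :
  prime p -> pro_p p G -> open N -> normal_subgroup N ->
  exists (gT : finGroupType) (P : {group gT}) (f : G -> gT),
    [/\ {morph f : x y / x * y}, p.-group P, forall g, f g \in P,
        forall s, s \in P -> exists g, f g = s & forall g, N g <-> f g = 1].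
Proof.
move=> p_pr [_ _ _ pG] oN nN; have [k] := pG N oN nN.
have [sN NJ] := nN; have [N1 NM NV] := sN.
have p_gt0 : (0 < p ^ k)%N by rewrite expn_gt0 prime_gt0.
case/card_set_bijP => h [hfun hinj hsurj].
pose C (g : G) := [set g * z | z in N].
have cP g : (h (C g) < p ^ k)%N by apply: hfun; exists g.
pose c g : 'I_(p ^ k) := Ordinal (cP g).
have cE x y : c x = c y <-> N (x^-1 * y).
  split=> [/(congr1 val) /= hxy|Nxy].
    by apply/(lcoset_eqP _ _ sN)/hinj => //; apply/mem_set; [exists x|exists y].
  by apply/val_inj; rewrite /= /C (iffRL (lcoset_eqP _ _ sN) Nxy).
have c_surj i : exists g, c g = i.
  have [_ [g _ <-] hi] := hsurj i (ltn_ord i).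
  by exists g; apply/val_inj.
pose rep i := sval (cid (c_surj i)).
have repK i : c (rep i) = i by rewrite /rep; case: cid.
pose a g i := c (rep i * g).
(* Right multiplication is well defined on left cosets because [N] is normal. *)
have aE g x : a g (c x) = c (x * g).
  apply/cE; have /cE/(NJ _ g) := repK (c x).
  by rewrite /conjg invgM !mulgA.
have aK g : cancel (a g) (a g^-1).
  by move=> i; rewrite -(repK i) !aE mulgK.
pose f g : 'S_(p ^ k) := perm (can_inj (aK g)).
have fE g x : f g (c x) = c (x * g) by rewrite permE aE.
have fM : {morph f : x y / x * y}.
  move=> x y; apply/permP => i; rewrite -(repK i) permM !fE.
  by rewrite mulgA.
pose S := [set s : 'S_(p ^ k) | `[< exists g, f g = s >]]%SET.
have SP s : reflect (exists g, f g = s) (s \in S) by rewrite inE; exact: asboolP.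
have f1 : f 1 = 1 by apply: (@mulgI _ (f 1)); rewrite -fM !mulg1.
have gS : group_set S.
  apply/group_setP; split; first by apply/SP; exists 1.
  by move=> _ _ /SP[x <-] /SP[y <-]; apply/SP; exists (x * y).
have fcP x y : f x = f y <-> c x = c y.
  split=> [fxy|/cE cxy]; first by have := fE x 1; rewrite fxy fE !mul1g.
  apply/permP => i; rewrite -(repK i) !fE; apply/cE.
  by rewrite invgM -mulgA mulKg.
(* The action is regular: an element of [S] is determined by the image of the coset of 1, and every
   coset is such an image. *)
have cardS : #|S| = (p ^ k)%N.
  rewrite -[RHS]card_ord -(card_in_imset (f := fun s : 'S_(p ^ k) => s (c 1)) (D := mem S)).
    rewrite -cardsT; congr #|pred_of_set _|; apply/setP => i; rewrite inE; apply/imsetP.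
    by exists (f (rep i)); [apply/SP; exists (rep i)|rewrite fE mul1g repK].
  by move=> _ _ /SP[x <-] /SP[y <-]; rewrite !fE !mul1g => /fcP.
exists _, (group gS), f; split=> //.
- by rewrite /pgroup cardS pnatX pnat_id.
- by move=> g; apply/SP; exists g.
- by move=> s /SP.
- move=> g; rewrite -f1; split=> [Ng|/fcP/cE]; last by rewrite mulg1 => /NV; rewrite invgK.
  by apply/fcP/cE; rewrite mulg1; exact: NV.
Qed.

(** * The Zassenhaus filtration *)

Section zassenhaus.
Variables (p : nat) (G : topGroupType).
Hypothesis p_pr : prime p.
Let p_gt1 : (1 < p)%N := prime_gt1 p_pr.

Lemma zassenhausX i x : zassenhaus p (G := G) ((i + p.-1) %/ p)%N x ->
  (1 < i)%N -> zassenhaus p i (x ^+ p).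
Proof.
by move=> Dx i_gt1; rewrite zassenhausE //; apply: sub_gen_smallest; left; exists x.
Qed.

Lemma zassenhausR j k (x y : G) : (0 < j)%N -> (0 < k)%N ->
  zassenhaus p j x -> zassenhaus p k y -> zassenhaus p (j + k) [~ x, y].
Proof.
move=> j0 k0 Dx Dy; rewrite zassenhausE //; last by rewrite (@leq_add 1 1).
by apply: sub_gen_smallest; right; exists j, k, x, y.
Qed.

(** It suffices to compare consecutive terms, by induction on the index. From one term to the next
    the ceiling in the power generators grows by at most 1, which the induction hypothesis absorbs.
    For a commutator, one of its two indices is at least 2 and can be lowered by 1. *)
Lemma zassenhaus_anti i j : (i <= j)%N ->
  zassenhaus p (G := G) j `<=` zassenhaus p i.
Proof.
suff S n : zassenhaus p (G := G) n.+1 `<=` zassenhaus p n.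
  move=> /subnKC <-; elim: (j - i)%N => [|d IH]; first by rewrite addn0.
  by rewrite addnS => x /S/IH.
elim/ltn_ind: n => -[|[|n]] IH //.
have [cD sD] := zassenhaus_group p G n.+2.
rewrite {1}zassenhausE //; apply: closed_gen_min => // z [[x Dx <-]|].
  have p_gt0 := prime_gt0 p_pr; apply: zassenhausX => //; move: Dx.
  have := leq_div2r p (leqnSn (n.+2 + p.-1)%N).
  have : ((n.+3 + p.-1) %/ p <= ((n.+2 + p.-1) %/ p).+1)%N.
    apply: (@leq_trans ((p + (n.+2 + p.-1)) %/ p)).
      by apply: leq_div2r; rewrite addSn -add1n leq_add2r.
    by rewrite divnDl ?divnn ?p_gt0.
  have : ((n.+2 + p.-1) %/ p < n.+2)%N.
    by rewrite ltn_divLR //; nia.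
  rewrite -addSn; set a := (n.+3 + _) %/ p; set b := (n.+2 + _) %/ p => bn ab ba.
  have [->//|/eqP aNb] := eqVneq a b.
  have -> : a = b.+1 by apply/eqP; lia.
  exact: IH.
move=> [[|j1] [[|k] [x [y [[//= _ _ jk] [Dx Dy ->]]]]]].
case: j1 jk Dx => [|j1] jk Dx.
  case: k Dy jk => [|k] Dy jk //; have -> : n.+2 = (1 + k.+1)%N by lia.
  by apply: zassenhausR => //; apply: IH Dy; lia.
have -> : n.+2 = (j1.+1 + k.+1)%N by lia.
by apply: zassenhausR => //; apply: IH Dx; lia.
Qed.

(* Induction on #|P|: modulo a central subgroup Z of order p the image of the
   m-th term is trivial for some m; for large i the i-th term is then generated
   by p-th powers and commutators with an entry mapping into Z. *)
Lemma zassenhaus_finite_image (gT : finGroupType) (P : {group gT}) (f : G -> gT) :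
  {morph f : x y / x * y} -> p.-group P -> (forall g, f g \in P) ->
  (forall A : {set gT}, closed [set g | f g \in A]) ->
  exists m, forall i, (m <= i)%N -> zassenhaus p i `<=` [set g | f g = 1].
Proof.
move: {2}#|P| (leqnn #|P|) => n; elim: n gT P f => [|n IH] gT P f Pn fM pP fP fc.
  by have := cardG_gt0 P; rewrite ltnNge Pn.
have [P1|nP1] := eqVneq (P : {set gT}) 1%g.
  by exists 0%N => i _ g _ /=; have := fP g; rewrite P1 => /set1P.
have nZ1 : 'Z(P) != 1%g.
  by apply: contra_neq nP1 => /(trivg_center_pgroup pP).
have [_ pZ _] := pgroup_pdiv (pgroupS (center_sub P) pP) nZ1.
have [z Zz oz] := Cauchy p_pr pZ.
have nZP : <[z]> <| P by rewrite sub_center_normal // cycle_subG.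
have fN g : f g \in 'N(<[z]>) by exact: (fintype.subsetP (normal_norm nZP) _ (fP g)).
have [|x y||g|A|m Dm] := IH _ (P / <[z]>)%G (coset <[z]> \o f).
- rewrite -ltnS (leq_trans _ Pn) // ltn_quotient ?normal_sub //.
  by rewrite cycle_eq1 -order_eq1 oz gtn_eqF.
- by rewrite /= fM morphM.
- exact: quotient_pgroup.
- exact: mem_quotient.
- rewrite (_ : mkset _ = [set g : G | f g \in [set w | coset <[z]> w \in A]%SET]) //.
  by apply/seteqP; split=> g /=; rewrite inE.
have {}Dm i : (m <= i)%N -> forall g, zassenhaus p i g -> f g \in <[z]>.
  by move=> mi g /(Dm _ mi) /=; exact: coset_idr.
(* The summand [m * p] makes the ceiling of i / p at least [m], so p-th powers are taken of elements
   mapping into the group generated by [z], which has order p. Also i is at least 2m, so in j + k =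
   i one index is at least [m]. The extra 2 ensures 1 < i. *)
exists ((m * p).+2 + m)%N => i mi.
have i_gt1 : (1 < i)%N by apply: leq_trans mi.
rewrite zassenhausE //; apply: closed_gen_min.
- rewrite (_ : mkset _ = [set g : G | f g \in [set 1]%SET]) //.
  by apply/seteqP; split=> g /=; rewrite inE => /eqP.
- split=> [|x y /= fx fy|x /= fx]; rewrite /= ?(mulg_morph1 fM) //.
    by rewrite fM fx fy mulg1.
  by rewrite (mulg_morphV fM) fx invg1.
have Z1 y g : f y \in <[z]> -> commute (f y) (f g).
  move=> fy; have : f y \in 'Z(P) by move: fy; apply/fintype.subsetP; rewrite cycle_subG.
  by case/centerP => _ /(_ _ (fP g)).
move=> w [[x Dx <-]|[j [k [x [y [[j0 k0 jk] [Dx Dy ->]]]]]]] /=.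
  rewrite (mulg_morphX fM); apply/eqP; rewrite -order_dvdn -oz order_dvdG //.
  apply: Dm Dx; rewrite leq_divRL ?prime_gt0 //.
  by apply: leq_trans (leq_addr _ _); apply: leq_trans mi; lia.
rewrite (mulg_morphR fM); apply/eqP/commgP.
have [mj|jm] := leqP m j; first exact: Z1 (Dm _ mj _ Dx).
apply/commute_sym/Z1/(Dm k) => //; rewrite leqNgt; apply/negP => km.
by move: mi; rewrite -jk leqNgt; nia.
Qed.
End zassenhaus.

(** The complement is a union of cosets of the open kernel. *)
Lemma closed_finite_preimage (G : topGroupType) (gT : finGroupType) (f : G -> gT) :
  {morph f : x y / x * y} -> open [set g | f g = 1] ->
  forall A : {set gT}, closed [set g | f g \in A].
Proof.
move=> fM oK A; rewrite -openC.
rewrite (_ : ~` _ = \bigcup_(g in [set g | f g \notin A]) [set x | f (g^-1 * x) = 1]).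
  by apply: bigcup_open => g _; exact: open_lcoset oK.
apply/seteqP; split=> [g /negP gA|x [g /= gA]].
  by exists g => //=; rewrite mulVg mulg_morph1.
by rewrite fM (mulg_morphV fM) => /mulg1_eq; rewrite invgK => <-; apply/negP.
Qed.

(** A nontrivial [x] survives in some finite p-quotient of [G], where the images of the filtration
    are eventually trivial. *)
Lemma pro_p_zassenhaus_trivial p (G : topGroupType) (x : G) : prime p ->
  pro_p p G -> (forall i, (2 <= i)%N -> zassenhaus p i x) -> x = 1.
Proof.
move=> p_pr pG Dx; have [cG hG tG _] := pG; apply/eqP; apply: contrapT => /negP x1.
have : nbhs (1 : G) (~` [set x]).
  apply: open_nbhs_nbhs; split; last by move=> /= x1'; rewrite -x1' eqxx in x1.
  by apply: closed_openC; exact: hausdorff_closed1.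
case/(open_normal_basis cG hG tG) => N [oN nN Nx].
have [gT [P [f [fM pP fP _ fN]]]] := pro_p_finite_quotient p_pr pG oN nN.
have oK : open [set g | f g = 1].
  by rewrite (_ : mkset _ = N) //; apply/seteqP; split=> g; rewrite /= fN.
have [m Dm] := zassenhaus_finite_image p_pr fM pP fP (closed_finite_preimage fM oK).
by apply: (Nx x) => //; apply/fN/(Dm (m + 2)%N); [exact: leq_addr|apply: Dx; exact: leq_addl].
Qed.

(** The Frattini subgroup of a finite p-group is generated by its commutators and p-th powers, which
    are the images of the generators of [zassenhaus p 2]. *)
Lemma zassenhaus2_Phi p (G : topGroupType) (gT : finGroupType) (P : {group gT}) (f : G -> gT) :
  prime p -> {morph f : x y / x * y} -> p.-group P -> (forall g, f g \in P) ->
  open [set g | f g = 1] -> forall x, zassenhaus p 2 x -> f x \in 'Phi(P).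
Proof.
move=> p_pr fM pP fP oK; suff: zassenhaus p 2 `<=` [set x | f x \in 'Phi(P)] by [].
rewrite zassenhausE ?prime_gt1 //; apply: closed_gen_min.
- exact: closed_finite_preimage.
- split=> [|x y /=|x /=]; rewrite /= ?(mulg_morph1 fM) //.
    by rewrite fM; exact: groupM.
  by rewrite (mulg_morphV fM) groupV.
move=> w [[x Dx <-]|[j [k [x [y [_ [_ _ ->]]]]]]] /=; rewrite (Phi_joing pP).
  rewrite (mulg_morphX fM); apply: (fintype.subsetP (joing_subr _ _)).
  by have := Mho_p_elt 1 (fP x) (mem_p_elt pP (fP x)); rewrite expn1.
by rewrite (mulg_morphR fM); apply: (fintype.subsetP (joing_subl _ _)); exact: mem_commg.
Qed.

(** * Quotients *)

Lemma sigma_iso_refl (G : sigmaGroupType) : sigma_iso G G.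
Proof. by exists id, id; split=> //; split=> // x; exact: cvg_id. Qed.

Lemma sigma_iso_sym (G H : sigmaGroupType) : sigma_iso G H -> sigma_iso H G.
Proof.
move=> [f [g [fK gK fh gh fs]]]; exists g, f; split=> // x.
by apply: (can_inj fK); rewrite fs !gK.
Qed.

Lemma continuous_hom_comp (G H K : topGroupType) (f : G -> H) (g : H -> K) :
  continuous_hom f -> continuous_hom g -> continuous_hom (g \o f).
Proof.
move=> [fM fc] [gM gc]; split=> [x y /=|x]; first by rewrite fM gM.
exact: continuous_comp (fc x) (gc _).
Qed.

Lemma sigma_iso_trans (G H K : sigmaGroupType) :
  sigma_iso G H -> sigma_iso H K -> sigma_iso G K.
Proof.
move=> [f [g [fK gK fh gh fs]]] [f' [g' [fK' gK' fh' gh' fs']]].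
exists (f' \o f), (g \o g'); split; [exact: can_comp|exact: can_comp| | |].
- exact: continuous_hom_comp.
- exact: continuous_hom_comp.
- by move=> x /=; rewrite fs fs'.
Qed.

(** Together with continuity, the last clause says that [Q] carries the quotient topology. The
    notion covers projections to quotients, isomorphisms and their composites, so that these are
    treated uniformly. *)
Definition sigma_quotient_map (G Q : sigmaGroupType) (f : G -> Q) : Prop :=
  [/\ continuous_hom f, {morph f : x / sigma x}, forall a, exists x, f x = a &
      forall V : set Q, open (f @^-1` V) -> open V].

Lemma to_quot_quotient_map (G : sigmaGroupType) (N : sigmaNormal G) :
  sigma_quotient_map (@to_quot G N).
Proof.
split=> //.
- by split; [exact: to_quotM|exact: to_quot_continuous].
- by move=> x; exact/esym/quot_sigmaE.
- by move=> a; have [x ->] := to_quot_surj a; exists x.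
Qed.

Lemma to_quot_eq1 (G : sigmaGroupType) (N : sigmaNormal G) x :
  to_quot N x = 1 <-> sn_set N x.
Proof.
have N1 : sn_set N x -> sn_set N x^-1 by case: (sn_normal N) => -[_ _ +] _; apply.
have N2 : sn_set N x^-1 -> sn_set N x.
  by case: (sn_normal N) => -[_ _ +] _ => /[apply]; rewrite invgK.
have := to_quotP N x 1; rewrite mulg1 => xP.
by split=> [/xP|/N1/xP].
Qed.

Lemma sigma_quotient_map_comp (G H K : sigmaGroupType) (f : G -> H) (g : H -> K) :
  sigma_quotient_map f -> sigma_quotient_map g -> sigma_quotient_map (g \o f).
Proof.
move=> [fh fs fS fo] [gh gs gS go]; split.
- exact: continuous_hom_comp.
- by move=> x /=; rewrite fs gs.
- by move=> a; have [b <-] := gS a; have [x <-] := fS b; exists x.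
- by move=> V oV; exact/go/fo.
Qed.

Lemma sigma_quotient_map_iso (G H : sigmaGroupType) (f : G -> H) (g : H -> G) :
  cancel f g -> cancel g f -> continuous_hom f -> continuous_hom g ->
  {morph f : x / sigma x} -> sigma_quotient_map f.
Proof.
move=> fK gK fh [_ /continuousP gc] fs; split=> // [a|V oV]; first by exists (g a).
rewrite (_ : V = g @^-1` (f @^-1` V)); first exact: gc.
by apply/seteqP; split=> x /=; rewrite gK.
Qed.

(** The factorisation is [h] composed with a set-theoretic section of [f]. The kernel condition
    makes it independent of the section, and the quotient topology makes it continuous. *)
Lemma quotient_map_lift (G Q : sigmaGroupType) (T : topGroupType)
    (f : G -> Q) (h : G -> T) :
  sigma_quotient_map f -> continuous_hom h -> (forall x, f x = 1 -> h x = 1) ->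
  exists2 k : Q -> T, continuous_hom k & forall x, k (f x) = h x.
Proof.
move=> [[fM _] _ fS fo] [hM hc] fh.
pose s a := sval (cid (fS a)); have sK a : f (s a) = a by rewrite /s; case: cid.
have fhE x y : f x = f y -> h x = h y.
  move=> fxy; have : h (x^-1 * y) = 1.
    by apply: fh; rewrite fM (mulg_morphV fM) fxy mulVg.
  by rewrite hM (mulg_morphV hM) => /mulg1_eq; rewrite invgK.
have sE x : h (s (f x)) = h x by apply: fhE; rewrite sK.
exists (h \o s) => //; split=> [a b /=|]; first by rewrite -hM; apply: fhE; rewrite fM !sK.
apply/continuousP => V oV; apply: fo; rewrite -comp_preimage.
rewrite (_ : _ \o _ = h); first by move/continuousP: hc; apply.
by apply/funext => x; exact: sE.
Qed.

Lemma quot_sigma_iso (G Q : sigmaGroupType) (N : sigmaNormal G) (f : G -> Q) :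
  sigma_quotient_map f -> (forall x, sn_set N x <-> f x = 1) ->
  sigma_iso (quot N) Q.
Proof.
move=> fq Nf; have [fh fs fS _] := fq.
have qq := to_quot_quotient_map N; have [qh qs _ _] := qq.
have [k kh kE] := quotient_map_lift qq fh (fun x => iffLR (iff_trans (to_quot_eq1 N x) (Nf x))).
have [l lh lE] := quotient_map_lift fq qh (fun x => iffRL (iff_trans (to_quot_eq1 N x) (Nf x))).
exists k, l; split=> //.
- by move=> a; have [x ->] := to_quot_surj a; rewrite kE lE.
- by move=> b; have [x <-] := fS b; rewrite lE kE.
- by move=> a; have [x ->] := to_quot_surj a; rewrite -qs !kE fs.
Qed.

(** * The Zassenhaus filtration and H^1 under quotient maps *)

Section zassenhaus_quotients.
Variable p : nat.
Hypothesis p_pr : prime p.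
Let p_gt1 : (1 < p)%N := prime_gt1 p_pr.

Lemma zassenhaus_hom (G H : topGroupType) (f : G -> H) i x :
  continuous_hom f -> zassenhaus p i x -> zassenhaus p i (f x).
Proof.
move=> [fM fc]; elim/ltn_ind: i x => -[|[|i]] // IH x.
have [cD sD] := zassenhaus_group p H i.+2.
suff S : zassenhaus p i.+2 `<=` f @^-1` zassenhaus p i.+2 by exact: S.
rewrite {1}zassenhausE //; apply: closed_gen_min.
- by move/continuous_closedP: fc; apply.
- exact: preimage_subgroup.
move=> z [[a Dx <-]|[j [k [a [b [[j0 k0 jk] [Dx Dy ->]]]]]]] /=.
  rewrite (mulg_morphX fM); apply: zassenhausX => //; apply: IH => //.
  by rewrite ltn_divLR ?prime_gt0 //; nia.
by rewrite (mulg_morphR fM) -jk; apply: zassenhausR => //; apply: IH => //; lia.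
Qed.

(** The point is that D_j(Q) is the image of D_j(G). Since the kernel of [f] lies in D_i(G), hence
    in D_j(G), the preimage of this image is D_j(G) itself; so the image is closed for the quotient
    topology. By induction on the index it contains the generators of D_j(Q). *)
Lemma zassenhaus_quotient_map (G Q : sigmaGroupType) (f : G -> Q) i :
  sigma_quotient_map f -> (forall x, f x = 1 -> zassenhaus p i x) ->
  forall j x, (j <= i)%N -> zassenhaus p j (f x) <-> zassenhaus p j x.
Proof.
move=> [fh fs fS fo] kD j x ji; split; last exact: zassenhaus_hom.
have [fM fc] := fh.
have fD l y : (l <= i)%N -> (f @` zassenhaus p l) (f y) -> zassenhaus p l y.
  move=> li [z Dz zy]; have [_ [_ DM _]] := zassenhaus_group p G l.
  rewrite -(mulVKg z y); apply: DM => //; apply: (zassenhaus_anti p_pr li).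
  by apply: kD; rewrite fM (mulg_morphV fM) zy mulVg.
suff S l : (l <= i)%N -> zassenhaus p l `<=` f @` zassenhaus p (G := G) l.
  by move=> /(S _ ji) /fD; apply.
elim/ltn_ind: l => -[|[|l]] IH li.
- by move=> a _; have [z <-] := fS a; exists z.
- by move=> a _; have [z <-] := fS a; exists z.
have [cD sD] := zassenhaus_group p G l.+2; have [D1 DM DV] := sD.
rewrite {1}zassenhausE //; apply: closed_gen_min.
- rewrite -openC; apply: fo.
  rewrite (_ : _ @^-1` _ = ~` zassenhaus p l.+2); first exact: closed_openC.
  apply/seteqP; split=> y /= ny Dy; apply: ny; last exact: fD Dy.
  by exists y.
- split=> [|_ _ [y Dy <-] [z Dz <-]|_ [y Dy <-]].
  + by exists 1 => //; rewrite (mulg_morph1 fM).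
  + by exists (y * z); [exact: DM|rewrite fM].
  + by exists y^-1; [exact: DV|rewrite (mulg_morphV fM)].
move=> z [[a Da <-]|[j' [k [a [b [[j0 k0 jk] [Da Db ->]]]]]]].
  have lt : ((l.+2 + p.-1) %/ p < l.+2)%N by rewrite ltn_divLR ?prime_gt0 //; nia.
  have [y Dy <-] := IH _ lt (leq_trans (ltnW lt) li) _ Da.
  by exists (y ^+ p); [exact: zassenhausX|rewrite (mulg_morphX fM)].
have [||y Dy <-] := IH j' _ _ _ Da; [lia|lia|].
have [||w Dw <-] := IH k _ _ _ Db; [lia|lia|].
by exists [~ y, w]; [rewrite -jk; exact: zassenhausR|rewrite (mulg_morphR fM)].
Qed.

Lemma quot_zassenhaus_iso (G Q : sigmaGroupType) (f : G -> Q) i :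
  sigma_quotient_map f -> (forall x, f x = 1 -> zassenhaus p i x) ->
  sigma_iso (quot_zassenhaus p G i) (quot_zassenhaus p Q i).
Proof.
move=> fq kD.
apply: (quot_sigma_iso (sigma_quotient_map_comp fq (to_quot_quotient_map _))) => x.
by rewrite /= to_quot_eq1 /= (zassenhaus_quotient_map fq kD).
Qed.

Lemma sigma_iso_zassenhaus (G H : sigmaGroupType) i :
  sigma_iso G H -> sigma_iso (quot_zassenhaus p G i) (quot_zassenhaus p H i).
Proof.
move=> [f [g [fK gK fh gh fs]]].
apply: (quot_zassenhaus_iso (sigma_quotient_map_iso fK gK fh gh fs)) => x fx1.
have -> : x = 1 by rewrite -(fK x) fx1 (mulg_morph1 gh.1).
by have [_ []] := zassenhaus_group p G i.
Qed.

(** The quotient K/D_i(K) can be recovered from L = K/D_m(K) as L/D_i(L). *)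
Lemma sigma_iso_zassenhaus_le (G H : sigmaGroupType) i m : (i <= m)%N ->
  sigma_iso (quot_zassenhaus p G m) (quot_zassenhaus p H m) ->
  sigma_iso (quot_zassenhaus p G i) (quot_zassenhaus p H i).
Proof.
move=> im GH.
have quotD (K : sigmaGroupType) : sigma_iso (quot_zassenhaus p K i)
    (quot_zassenhaus p (quot_zassenhaus p K m) i).
  apply: quot_zassenhaus_iso (to_quot_quotient_map _) _ => x /to_quot_eq1.
  exact: zassenhaus_anti.
apply: sigma_iso_trans (quotD G) _.
exact: sigma_iso_trans (sigma_iso_zassenhaus i GH) (sigma_iso_sym (quotD H)).
Qed.

Lemma H1_zassenhaus2 (G : topGroupType) (f : G -> 'F_p) :
  H1 f -> forall x, zassenhaus p 2 x -> f x = 0%R.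
Proof.
move=> [fD fo]; have f1 : f 1 = 0%R.
  by apply: (@GRing.addrI _ (f 1)); rewrite -fD mulg1 GRing.addr0.
have fV x : f x^-1 = (- f x)%R.
  by apply: (@GRing.addrI _ (f x)); rewrite -fD mulgV f1 GRing.addrN.
suff: zassenhaus p 2 `<=` [set x | f x = 0%R] by [].
rewrite zassenhausE //; apply: closed_gen_min.
- rewrite -openC (_ : ~` _ = f @^-1` (~` [set 0%R])); first exact: fo.
  by apply/seteqP; split.
- split=> [|x y /= fx fy|x /= fx]; rewrite /= ?f1 //.
    by rewrite fD fx fy GRing.addr0.
  by rewrite fV fx GRing.oppr0.
move=> z [[x Dx <-]|[j [k [x [y [_ [_ _ ->]]]]]]] /=.
  have fX n : f (x ^+ n) = (f x *+ n)%R.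
    by elim: n => [|n IH]; rewrite ?f1 // expgS fD IH GRing.mulrS.
  by rewrite fX -GRing.mulr_natr pchar_Fp_0 // GRing.mulr0.
by rewrite /commg /conjg !fD !fV GRing.addrA -GRing.opprD GRing.addNr.
Qed.

(** Composition with [f] is a bijection from [H1] of [Q] to [H1] of [G], along which bases are
    transported. Its inverse is composition with a set-theoretic section [s]: homomorphisms to F_p
    kill D_2(G), hence the kernel of [f]. *)
Lemma dim_H1_quotient_map (G Q : sigmaGroupType) (f : G -> Q) d :
  sigma_quotient_map f -> (forall x, f x = 1 -> zassenhaus p 2 x) ->
  dim_H1_is p G d <-> dim_H1_is p Q d.
Proof.
move=> [[fM fc] _ fS fo] kD.
have H1f (u : Q -> 'F_p) : H1 u -> H1 (u \o f).
  move=> [uD uo]; split=> [x y /=|A]; first by rewrite fM uD.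
  by move/continuousP: fc => /(_ _ (uo A)).
pose s (b : Q) := sval (cid (fS b)).
have sK b : f (s b) = b by rewrite /s; case: cid.
have H1s (u : G -> 'F_p) : H1 u -> (u \o s) \o f = u.
  move=> uH; apply/funext => x /=; have [uD _] := uH.
  rewrite -[in RHS](mulVKg (s (f x)) x) uD (H1_zassenhaus2 uH (x := _^-1 * _)) ?GRing.addr0 //.
  by apply: kD; rewrite fM (mulg_morphV fM) sK mulVg.
have H1s' (u : G -> 'F_p) : H1 u -> H1 (u \o s).
  move=> uH; have us := H1s _ uH; case: (uH) => uD uo; split=> [a b|A].
    have usE x : u x = u (s (f x)) by rewrite -[in LHS]us.
    by rewrite /= -uD [RHS]usE fM !sK.
  by apply: (fo ((u \o s) @^-1` A)); rewrite -comp_preimage us; exact: uo.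
have fI (u v : Q -> 'F_p) : u \o f = v \o f -> u = v.
  by move=> uv; apply/funext => a; rewrite -(sK a); exact: (congr1 (@^~ (s a)) uv).
split=> -[b [bH bB]].
  exists (fun i => b i \o s); split=> [i|u uH]; first exact: H1s'.
  have [c [cE cU]] := bB _ (H1f _ uH); exists c; split=> [|c' uc'].
    apply: fI; rewrite cE; apply/funext => x /=; apply: eq_bigr => i _.
    by rewrite -[in LHS](H1s (b i)).
  apply: cU; rewrite uc'; apply/funext => x /=; apply: eq_bigr => i _.
  by rewrite -[in RHS](H1s (b i)).
exists (fun i => b i \o f); split=> [i|u uH]; first exact: H1f.
have [c [cE cU]] := bB _ (H1s' _ uH); exists c; split=> [|c' uc'].
  by rewrite -[LHS]H1s // cE.
by apply: cU; apply: fI; rewrite H1s.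
Qed.

End zassenhaus_quotients.

(** * Free pro-p groups *)

(** The quotient is discrete. Taking preimages matches the cosets of a normal subgroup [V] with
    those of its preimage in [F], so the index is again a power of p. *)
Lemma quot_open_pro_p p (F : sigmaGroupType) (K : sigmaNormal F) :
  pro_p p F -> open (sn_set K) -> pro_p p (quot K).
Proof.
move=> [cF _ _ pF] oK; have [sK _] := sn_normal K.
have qo (A : set (quot K)) : open A.
  rewrite /open /= /quot_open.
  rewrite (_ : _ @^-1` _ = \bigcup_(g in to_quot K @^-1` A) [set x | sn_set K (g^-1 * x)]).
    by apply: bigcup_open => g _; exact: open_lcoset.
  apply/seteqP; split=> [g Ag|g [h /= Ah /to_quotP hg]]; last by rewrite /= -hg.
  by exists g => //=; rewrite mulVg; case: sK.
have q0 : zero_dimensional (quot K).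
  move=> a b ab; exists [set a]; split=> //; last by move=> /= ba; rewrite ba eqxx in ab.
  by split=> //; rewrite -openC.
split.
- have -> : [set: quot K] = to_quot K @` setT.
    by apply/seteqP; split=> // a _; have [x ->] := to_quot_surj a; exists x.
  by apply: continuous_compact => //; apply: continuous_subspaceT; exact: to_quot_continuous.
- rewrite open_hausdorff => a b ab; exists ([set a], [set b]).
    by rewrite !inE.
  split=> //; apply/eqP/seteqP; split=> // c [/= -> ba]; by rewrite ba eqxx in ab.
- exact: zero_dimension_totally_disconnected.
move=> V oV [sV nV].
have [||k Mk] := pF (to_quot K @^-1` V) _ _; first exact: oV.
  split; first exact/(preimage_subgroup (to_quotM K)).
  by move=> x g /=; rewrite (mulg_morphJ (to_quotM K)); exact: nV.
exists k; apply: card_eq_trans Mk; rewrite card_eq_sym.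
have coset_preim g : [set g * x | x in to_quot K @^-1` V] =
    to_quot K @^-1` [set to_quot K g * v | v in V].
  apply/seteqP; split=> [_ [x Vx <-]|x [v Vv vx]] /=.
    by exists (to_quot K x) => //; rewrite to_quotM.
  exists (g^-1 * x); last by rewrite mulVKg.
  by rewrite /= to_quotM (mulg_morphV (to_quotM K)) -vx mulKg.
have -> : range (fun g : F => [set g * x | x in to_quot K @^-1` V]) =
    preimage (to_quot K) @` range (fun a : quot K => [set a * v | v in V]).
  apply/seteqP; split=> [_ [g _ <-]|_ [_ [a _ <-] <-]].
    by exists [set to_quot K g * v | v in V] => //; exists (to_quot K g).
  by have [g ->] := to_quot_surj a; exists g.
apply: inj_card_eq => A B _ _ AB; apply/funext => a.
by have [x ->] := to_quot_surj a; exact: (congr1 (@^~ x) AB).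
Qed.

(* Let N be open, normal and sigma-stable, and K the closed subgroup generated *)
(* by the x_i, D_2(F) and N. Then F / K is a pro-p group, in which all x_i     *)
(* become trivial, so K = F by uniqueness in the universal property. As D_2(F) *)
(* maps into the Frattini subgroup of F / N, the x_i generate F modulo N.      *)
Lemma free_pro_p_generated p n (F : sigmaGroupType) (x : 'I_n -> F) :
  prime p -> free_pro_p p x -> (forall i, sigma (x i) = (x i)^-1) ->
  forall g, closed_gen (range x) g.
Proof.
move=> p_pr [pF uF] xs g; have [cF hF tF _] := pF.
set H := closed_gen (range x); have cH : closed H by exact: closed_gen_closed.
have sH : subgroup H by exact: closed_gen_subgroup.
have [H1 HM HV] := sH.
apply: contrapT => Hg.
(* Since [H] is closed and misses [g], there is an open normal [N0] with [g] outside the product of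
   [H] and [N0]. *)
have : nbhs (1 : F) [set z | ~ H (g * z^-1)].
  apply: open_nbhs_nbhs; split; last by rewrite /= invg1 mulg1.
  rewrite (_ : mkset _ = (fun z => g * z^-1) @^-1` (~` H)) //.
  have cg : continuous (fun z : F => g * z^-1).
    by apply: mulg_cts => z; [exact: cvg_cst|exact: invg_continuous].
  by move/continuousP: cg; apply; exact: closed_openC.
case/(open_normal_basis cF hF tF) => N0 [oN0 [[N1 NM NV] NJ] N0H].
(* Intersecting with the preimage under [sigma] makes the subgroup stable under [sigma]. *)
pose N := [set z | N0 z /\ N0 (sigma z)].
have sM := @sigmaM F; have sV := mulg_morphV sM.
have oN : open N.
  by apply: openI => //; have /continuousP := @sigma_continuous F; apply.
have nN : normal_subgroup N.
  split; first split.
  - by split; rewrite ?(mulg_morph1 sM).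
  - by move=> a b [Na Nsa] [Nb Nsb]; split; rewrite ?sM; exact: NM.
  - by move=> a [Na Nsa]; split; rewrite ?sV; exact: NV.
  - by move=> a h [Na Nsa]; split; rewrite ?(mulg_morphJ sM); exact: NJ.
pose S := range x `|` zassenhaus p 2 `|` N.
pose K := closed_gen S.
have [K1 KM KV] : subgroup K by exact: closed_gen_subgroup.
have KD z : zassenhaus p 2 z -> K z by move=> Dz; apply: sub_gen_smallest; left; right.
(* [K] contains D_2(F) and hence all commutators. *)
have nK : normal_subgroup K.
  split=> // z h Kz; have -> : z ^ h = z * [~ z, h] by rewrite commgEl mulVKg.
  apply: KM => //; apply: KD.
  exact: (@zassenhausR p F p_pr 1 1).
have Ks z : K z -> K (sigma z).
  apply: closed_gen_morph; [exact: sigmaM|exact: sigma_continuous|].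
  move=> {}z [[[i _ <-]|Dz]|[Nz Nsz]].
  - by rewrite xs; apply: KV; apply: sub_gen_smallest; left; left; exists i.
  - by apply: KD; exact: zassenhaus_sigma.
  - by apply: sub_gen_smallest; right; split; rewrite ?sigmaK.
have oK : open K.
  apply: open_subgroup => //; apply: filterS (open_nbhs_nbhs _).
    by move=> z Nz; apply: sub_gen_smallest; right; exact: Nz.
  by split=> //; case: nN => -[].
pose Ksn := SigmaNormal (@closed_gen_closed _ S) nK Ks.
have KT z : K z.
  have [f [_ fU]] := uF (quot Ksn) (fun=> 1) (quot_open_pro_p (K := Ksn) pF oK).
  apply/(to_quot_eq1 Ksn).
  have fq : f = to_quot Ksn.
    apply: fU; split=> [|i]; first by split; [exact: to_quotM|exact: to_quot_continuous].
    by apply/to_quot_eq1; apply: (@sub_gen_smallest _ _ S); left; left; exists i.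
  have f1 : f = fun=> 1.
    apply: fU; split=> //; split=> [a b|a]; first by rewrite mulg1.
    exact: cvg_cst.
  by rewrite -fq f1.
have [gT [P [f [fM pP fP fS fN]]]] := pro_p_finite_quotient p_pr pF oN nN.
have oker : open [set a | f a = 1].
  by rewrite (_ : mkset _ = N) //; apply/seteqP; split=> a; rewrite /= fN.
pose T := [set s | `[< exists2 h, H h & f h = s >]]%SET.
have TP s : reflect (exists2 h, H h & f h = s) (s \in T) by rewrite inE; exact: asboolP.
have gT' : group_set T.
  apply/group_setP; split; first by apply/TP; exists 1; rewrite ?(mulg_morph1 fM).
  move=> _ _ /TP[a Ha <-] /TP[b Hb <-]; apply/TP; exists (a * b) => //.
  exact: HM.
have TsP : T \subset P by apply/fintype.subsetP => _ /TP[a _ <-].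
have KT' : K `<=` [set a | f a \in 'Phi(P) <*> T].
  apply: closed_gen_min.
  - exact: closed_finite_preimage.
  - split=> [|a b /=|a /=]; rewrite /= ?(mulg_morph1 fM) //.
      by rewrite fM; exact: groupM.
    by rewrite (mulg_morphV fM) groupV.
  move=> a [[[i _ <-]|Da]|/fN /= ->]; last exact: group1.
    apply: (fintype.subsetP (joing_subr _ _)); apply/TP; exists (x i) => //.
    by apply: sub_gen_smallest; exists i.
  apply: (fintype.subsetP (joing_subl _ _)).
  exact: (zassenhaus2_Phi p_pr fM pP fP oker).
have TP' : <<T>> = P.
  apply: Phi_nongen; apply/eqP; rewrite finset.eqEsubset join_subG Phi_sub TsP /=.
  by apply/fintype.subsetP => s /fS[a <-]; exact: KT'.
have : f g \in T by have := fP g; rewrite -TP' (gen_set_id gT').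
(* Now [g] is congruent modulo [N] to an element of [H], against the choice of [N0]. *)
case/TP => h Hh hg; have /fN [/N0H /=] : f (h^-1 * g) = 1.
  by rewrite fM (mulg_morphV fM) hg mulVg.
by rewrite invgM invgK mulVKg.
Qed.

(** The elements on which [f] and [h] are congruent modulo [N] form a closed subgroup, closed under
    products and inverses by normality of [N]. *)
Lemma homs_agree_mod (F H : topGroupType) (f h : F -> H) (S : set F) (N : set H) :
  continuous_hom f -> continuous_hom h -> closed N -> normal_subgroup N ->
  (forall a, S a -> N ((f a)^-1 * h a)) ->
  forall a, closed_gen S a -> N ((f a)^-1 * h a).
Proof.
move=> [fM fc] [hM hc] cN [[N1 NM NV] NJ] SN.
suff: closed_gen S `<=` [set a | N ((f a)^-1 * h a)] by [].
apply: closed_gen_min => //.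
- rewrite (_ : mkset _ = (fun a => (f a)^-1 * h a) @^-1` N) //.
  have fhc : continuous (fun a => (f a)^-1 * h a).
    apply: mulg_cts => // a; exact: (continuous_comp (fc a) (@invg_continuous H _)).
  by move/continuous_closedP: fhc; apply.
split=> [|a b /= Na Nb|a /= Na]; rewrite /= ?(mulg_morph1 fM) ?(mulg_morph1 hM).
- by rewrite mulVg.
- have := NM _ _ (NJ _ (f b) Na) Nb; rewrite fM hM /conjg !invgM -!mulgA.
  by rewrite mulVKg.
- have := NJ _ (f a)^-1 (NV _ Na).
  by rewrite (mulg_morphV fM) (mulg_morphV hM) /conjg invgM !invgK -!mulgA mulgV mulg1.
Qed.

Lemma homs_agree (F H : topGroupType) (f h : F -> H) (S : set F) :
  continuous_hom f -> continuous_hom h -> closed [set 1 : H] ->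
  (forall a, S a -> f a = h a) -> forall a, closed_gen S a -> f a = h a.
Proof.
move=> fh hh c1 Sfh a Sa.
have n1 : normal_subgroup [set 1 : H].
  split=> [|_ g ->]; last by rewrite /= conj1g.
  by split=> // [_ _ -> ->|_ ->] /=; rewrite ?mulg1 ?invg1.
have /(_ _ a Sa)/mulg1_eq := homs_agree_mod fh hh c1 n1 (S := S).
by rewrite invgK; apply=> b /Sfh -> /=; rewrite mulVg.
Qed.

Lemma closed_quot1 (G : sigmaGroupType) (N : sigmaNormal G) :
  closed [set 1 : quot N].
Proof.
rewrite -openC /open /= /quot_open.
rewrite (_ : _ @^-1` _ = ~` sn_set N); first exact/closed_openC/sn_closed.
by apply/seteqP; split=> x /= nx /to_quot_eq1.
Qed.

(** * Homomorphisms from a free pro-p group, parametrised by the images of the generators *)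

Section free_homs.
Variables (p n : nat) (F : sigmaGroupType) (x : 'I_n -> F).
Hypotheses (p_pr : prime p) (xF : free_pro_p p x).
Hypothesis xs : forall i, sigma (x i) = (x i)^-1.
Variable E : topGroupType.
Hypothesis pE : pro_p p E.

Lemma free_hom_exists (y : {ptws 'I_n -> E}) :
  exists f : F -> E, continuous_hom f /\ forall i, f (x i) = y i.
Proof. by have [f [fP _]] := xF.2 E y pE; exists f. Qed.

Definition free_hom y := sval (cid (free_hom_exists y)).

Lemma free_hom_hom y : continuous_hom (free_hom y).
Proof. by rewrite /free_hom; case: cid => f []. Qed.

Lemma free_homE y i : free_hom y (x i) = y i.
Proof. by rewrite /free_hom; case: cid => f []. Qed.

(** If y' is congruent to y modulo an open normal [N] at every generator, the two homomorphisms are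
    congruent modulo [N] on all of [F]. This uniformity, combined with continuity of [free_hom y] at
    b, gives joint continuity. *)
Lemma free_hom_continuous :
  continuous (fun t : {ptws 'I_n -> E} * F => free_hom t.1 t.2).
Proof.
have [cE hE tE _] := pE.
move=> [y b] U /= Uyb.
have : nbhs (1 : E) [set z | U (free_hom y b * z)].
  by apply: (@lmulg_cts E); rewrite mulg1.
case/(open_normal_basis cE hE tE) => N [oN nN NU].
have [[N1 NM NV] NJ] := nN; have cN := subgroup_closed nN.1 oN.
have Ny : nbhs y [set y' | forall i, N ((y i)^-1 * y' i)].
  apply: (@filter_forall _ _ (fun i (y' : {ptws 'I_n -> E}) => N ((y i)^-1 * y' i))
            _ (nbhs_filter y)) => i.
  have yi : continuous (fun y' : {ptws 'I_n -> E} => (y i)^-1 * y' i).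
    apply: (@mulg_cts E {ptws 'I_n -> E} (fun=> (y i)^-1) (fun y' => y' i)).
      exact: cst_continuous.
    exact: (@proj_continuous _ (fun=> E) i).
  by apply: (yi y N); rewrite mulVg; exact: open_nbhs_nbhs.
have Nb : \forall b' \near b, N ((free_hom y b)^-1 * free_hom y b').
  have yb : continuous (fun b' => (free_hom y b)^-1 * free_hom y b').
    by apply: mulg_cts; [move=> ?; exact: cvg_cst|exact: (free_hom_hom y).2].
  by apply: (yb b N); rewrite mulVg; exact: open_nbhs_nbhs.
exists ([set y' | forall i, N ((y i)^-1 * (y' i))],
        [set b' | N ((free_hom y b)^-1 * free_hom y b')]); first by split.
move=> [y' b'] [/= Ny' Nb'].
have Nyy' : N ((free_hom y b')^-1 * free_hom y' b').
  apply: (homs_agree_mod (free_hom_hom y) (free_hom_hom y') cN nN _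
            (free_pro_p_generated p_pr xF xs b')).
  by move=> _ [i _ <-]; rewrite !free_homE.
by have := NU _ (NM _ _ Nb' Nyy'); rewrite /= -!mulgA !mulVKg.
Qed.

(** Projectivity of free pro-p groups: lift the images of the generators arbitrarily, and compare on
    generators. *)
Lemma free_hom_lift (Q : topGroupType) (r : E -> Q) (h : F -> Q) :
  continuous_hom r -> (forall a, exists b, r b = a) -> closed [set 1 : Q] ->
  continuous_hom h -> exists y, forall a, r (free_hom y a) = h a.
Proof.
move=> rh rS c1 hh; have [y yE] := choice (fun i => rS (h (x i))).
exists y => a.
apply: (homs_agree (continuous_hom_comp (free_hom_hom y) rh) hh c1 _
          (free_pro_p_generated p_pr xF xs a)).
by move=> _ [i _ <-] /=; rewrite free_homE yE.
Qed.

End free_homs.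

(** * Weak Schur groups are determined by their Zassenhaus quotients *)

Lemma weak_schur_presentation p (G : sigmaGroupType) : weak_schur p G ->
  exists (n : nat) (F : sigmaGroupType) (x : 'I_n -> F) (f : F -> G),
    [/\ free_pro_p p x, forall i, sigma (x i) = (x i)^-1 & sigma_quotient_map f].
Proof.
move=> [_ [n [F [x [r [rminus [xF xs]]]]]]] /sigma_iso_sym [f [g [fK gK fh gh fs]]].
exists n, F, x, (f \o to_quot (relator_group rminus)); split=> //.
apply: sigma_quotient_map_comp (to_quot_quotient_map _) _.
exact: sigma_quotient_map_iso fK gK fh gh fs.
Qed.

Lemma zassenhaus_quotients_determine p (G H : sigmaGroupType) :
  prime p -> weak_schur p G -> weak_schur p H ->
  (forall i, (2 <= i)%N ->
     sigma_iso (quot_zassenhaus p G i) (quot_zassenhaus p H i)) ->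
  sigma_iso G H.
Proof.
move=> p_pr wG wH isoD; have [pG _] := wG; have [pH _] := wH.
have [n [F [x [r [xF xs rq]]]]] := weak_schur_presentation wG.
have [m [F' [x' [r' [xF' xs' rq']]]]] := weak_schur_presentation wH.
have [rh rs rS _] := rq; have [rh' rs' rS' _] := rq'.
have [[rM rc] [rM' rc']] := (rh, rh').
have [pF pF'] := (xF.1, xF'.1).
pose f := free_hom xF pF'; pose g := free_hom xF' pF.
have fh y : continuous_hom (f y) := free_hom_hom xF pF' y.
have gh z : continuous_hom (g z) := free_hom_hom xF' pF z.
have fE y j : f y (x j) = y j := free_homE xF pF' y j.
have gE z j : g z (x' j) = z j := free_homE xF' pF z j.
have fc : continuous (fun t => f t.1 t.2).
  exact: free_hom_continuous.
have gc : continuous (fun t => g t.1 t.2).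
  exact: free_hom_continuous.
pose T := ({ptws 'I_n -> F'} * {ptws 'I_m -> F})%type.
(* The conditions say, modulo D_i: the two homomorphisms encoded by [t] descend to [G] and [H],
   their composites fix the generators, and the first one commutes with [sigma] on generators. As
   [sigma] inverts each [x j], the latter means that it inverts the image of [t.1 j]. *)
pose good i (t : T) := [/\
  forall a, r a = 1 -> zassenhaus p i (r' (f t.1 a)),
  forall b, r' b = 1 -> zassenhaus p i (r (g t.2 b)),
  forall j, zassenhaus p i ((r (x j))^-1 * r (g t.2 (t.1 j))),
  forall j, zassenhaus p i ((r' (x' j))^-1 * r' (f t.1 (t.2 j))) &
  forall j, zassenhaus p i (r' (sigma (t.1 j) * t.1 j))].
have good_ex i : (2 <= i)%N -> exists t, good i t.
  move=> i2; have [phi [psi [phiK psiK phih psih phis]]] := isoD i i2.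
  pose q := to_quot (zassenhaus_sn p G i); pose q' := to_quot (zassenhaus_sn p H i).
  have [qh qs qS _] : sigma_quotient_map q := to_quot_quotient_map _.
  have [qh' qs' qS' _] : sigma_quotient_map q' := to_quot_quotient_map _.
  have qP a : q a = 1 <-> zassenhaus p i a := to_quot_eq1 _ _.
  have qP' a : q' a = 1 <-> zassenhaus p i a := to_quot_eq1 _ _.
  have [y yE] : exists y, forall a, (q' \o r') (f y a) = (phi \o (q \o r)) a.
    apply: free_hom_lift => //; [exact: continuous_hom_comp| |exact: closed_quot1|].
      by move=> a; have [b <-] := qS' a; have [c <-] := rS' b; exists c.
    by apply: continuous_hom_comp => //; exact: continuous_hom_comp.
  have [z zE] : exists z, forall b, (q \o r) (g z b) = (psi \o (q' \o r')) b.
    apply: free_hom_lift => //; [exact: continuous_hom_comp| |exact: closed_quot1|].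
      by move=> a; have [b <-] := qS a; have [c <-] := rS b; exists c.
    by apply: continuous_hom_comp => //; exact: continuous_hom_comp.
  rewrite /= in yE zE.
  have [phi1 psi1] := (mulg_morph1 phih.1, mulg_morph1 psih.1).
  have [qM qM'] := (qh.1, qh'.1).
  exists (y, z); split=> /=.
  - move=> a ra; apply/qP'; rewrite yE ra (mulg_morph1 qM).
    exact: phi1.
  - move=> b rb; apply/qP; rewrite zE rb (mulg_morph1 qM').
    exact: psi1.
  - move=> j; apply/qP; rewrite qM (mulg_morphV qM) zE -[y j]fE yE phiK.
    exact: mulVg.
  - move=> j; apply/qP'; rewrite qM' (mulg_morphV qM') yE -[z j]gE zE psiK.
    exact: mulVg.
  - move=> j; apply/qP'; rewrite rM' qM' rs' qs' -[y j]fE yE -phis -qs -rs xs.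
    rewrite (mulg_morphV rM) (mulg_morphV qM) (mulg_morphV phih.1).
    exact: mulVg.
(* The shift by 2 meets the bound 2 <= i. Since [good] gets stronger with the level, [u k] is good
   at every level up to k. *)
pose u k := sval (cid (good_ex k.+2 isT)).
have uP k i : (i <= k)%N -> good i (u k).
  move=> ik; have ik2 : (i <= k.+2)%N by exact: leq_trans ik (leq_addl 2 k).
  rewrite /u; case: cid => t [t1 t2 t3 t4 t5] /=.
  by split=> *; apply: (zassenhaus_anti p_pr ik2); auto.
have [cF _ _ _] := pF; have [cF' _ _ _] := pF'.
have [t _ ut] : exists2 t, [set: T] t & cluster (u @ \oo) t.
  have cT := compact_setX (compact_ptws (n := n) cF') (compact_ptws (n := m) cF).
  rewrite setXTT in cT; have [|t tP] := cT (u @ \oo) _; first exact: filterT.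
  by exists t; case: tP.
(* Each term of the filtration is closed, so the value at the cluster point [t] lies in all of them
   and is trivial. Thus congruences along the sequence become equalities at [t]. *)
have limH h : continuous h -> (forall i, (2 <= i)%N -> forall k, (i <= k)%N ->
    zassenhaus p i (h (u k) : H)) -> h t = 1.
  move=> hc hu; apply: (pro_p_zassenhaus_trivial p_pr pH) => i i2.
  by apply: (cluster_closed ut hc _ (hu i i2)); case: (zassenhaus_group p H i).
have limG h : continuous h -> (forall i, (2 <= i)%N -> forall k, (i <= k)%N ->
    zassenhaus p i (h (u k) : G)) -> h t = 1.
  move=> hc hu; apply: (pro_p_zassenhaus_trivial p_pr pG) => i i2.
  by apply: (cluster_closed ut hc _ (hu i i2)); case: (zassenhaus_group p G i).
have t1c : continuous (fun t : T => t.1) by move=> ?; exact: cvg_fst.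
have t2c : continuous (fun t : T => t.2) by move=> ?; exact: cvg_snd.
have t1jc j : continuous (fun t : T => t.1 j).
  move=> s.
  exact: (@continuous_comp T {ptws 'I_n -> F'} F' (fun t => t.1) (fun y => y j) s
            (t1c s) (@proj_continuous _ (fun=> F') j _)).
have t2jc j : continuous (fun t : T => t.2 j).
  move=> s.
  exact: (@continuous_comp T {ptws 'I_m -> F} F (fun t => t.2) (fun z => z j) s
            (t2c s) (@proj_continuous _ (fun=> F) j _)).
have fTc (h : T -> F) : continuous h -> continuous (fun t => r' (f t.1 (h t))).
  move=> hc s; apply: (@continuous_comp T F' H _ r' _ _ (rc' _)).
  apply: (@continuous_comp T ({ptws 'I_n -> F'} * F)%type F' (fun t => (t.1, h t))
            (fun w => f w.1 w.2) _ _ (fc _)).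
  exact: pair_cts (t1c s) (hc s).
have gTc (h : T -> F') : continuous h -> continuous (fun t => r (g t.2 (h t))).
  move=> hc s; apply: (@continuous_comp T F G _ r _ _ (rc _)).
  apply: (@continuous_comp T ({ptws 'I_m -> F} * F')%type F (fun t => (t.2, h t))
            (fun w => g w.1 w.2) _ _ (gc _)).
  exact: pair_cts (t2c s) (hc s).
have f1 a : r a = 1 -> r' (f t.1 a) = 1.
  move=> ra; apply: (limH (fun t => r' (f t.1 a))).
    by apply: (fTc (fun=> a)); exact: cst_continuous.
  by move=> i i2 k /uP[]; auto.
have g1 b : r' b = 1 -> r (g t.2 b) = 1.
  move=> rb; apply: (limG (fun t => r (g t.2 b))).
    by apply: (gTc (fun=> b)); exact: cst_continuous.
  by move=> i i2 k /uP[]; auto.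
have gf j : r (g t.2 (t.1 j)) = r (x j).
  have /mulg1_eq <- : (r (x j))^-1 * r (g t.2 (t.1 j)) = 1; last by rewrite invgK.
  apply: (limG (fun t => (r (x j))^-1 * r (g t.2 (t.1 j)))).
    by apply: mulg_cts; [exact: cst_continuous|exact: gTc].
  by move=> i i2 k /uP[]; auto.
have fg j : r' (f t.1 (t.2 j)) = r' (x' j).
  have /mulg1_eq <- : (r' (x' j))^-1 * r' (f t.1 (t.2 j)) = 1; last by rewrite invgK.
  apply: (limH (fun t => (r' (x' j))^-1 * r' (f t.1 (t.2 j)))).
    by apply: mulg_cts; [exact: cst_continuous|exact: fTc].
  by move=> i i2 k /uP[]; auto.
have fs j : r' (sigma (t.1 j)) = (r' (t.1 j))^-1.
  apply/invg_inj; rewrite invgK; apply: mulg1_eq; rewrite -rM'.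
  apply: (limH (fun t => r' (sigma (t.1 j) * t.1 j))).
    move=> s; apply: (@continuous_comp T F' H _ r' _ _ (rc' _)).
    apply: mulg_cts s => // s; apply: (@continuous_comp T F' F' _ sigma _ (t1jc j s)).
    exact: sigma_continuous.
  by move=> i i2 k /uP[]; auto.
have [c1 c1'] : closed [set 1 : G] /\ closed [set 1 : H].
  by case: pG pH => _ hG _ _ [_ hH _ _]; split; exact: hausdorff_closed1.
have genF := free_pro_p_generated p_pr xF xs.
have genF' := free_pro_p_generated p_pr xF' xs'.
(* The homomorphisms at the cluster point descend exactly. That they are mutually inverse and
   commute with [sigma] is then checked on the generators. *)
have [phi phih phiE] := quotient_map_lift rq (continuous_hom_comp (fh t.1) rh') f1.
have [psi psih psiE] := quotient_map_lift rq' (continuous_hom_comp (gh t.2) rh) g1.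
exists phi, psi; split=> //.
- move=> a; have [b <-] := rS a.
  apply: (homs_agree _ rh c1 _ (genF b) (f := psi \o (phi \o r))).
    by apply: continuous_hom_comp => //; exact: continuous_hom_comp.
  by move=> _ [j _ <-]; rewrite /= phiE /= psiE /= fE gf.
- move=> a; have [b <-] := rS' a.
  apply: (homs_agree _ rh' c1' _ (genF' b) (f := phi \o (psi \o r'))).
    by apply: continuous_hom_comp => //; exact: continuous_hom_comp.
  by move=> _ [j _ <-]; rewrite /= psiE /= phiE /= gE fg.
move=> a; have [b <-] := rS a.
have sF : continuous_hom (sigma : F -> F) by split; [exact: sigmaM|exact: sigma_continuous].
have sH : continuous_hom (sigma : H -> H) by split; [exact: sigmaM|exact: sigma_continuous].
rewrite -rs !phiE /=.
apply: (homs_agree (f := r' \o (f t.1 \o sigma)) (h := sigma \o (r' \o f t.1)) _ _ c1' _ (genF b)).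
- by do 2 apply: continuous_hom_comp => //.
- by do 2 apply: continuous_hom_comp => //.
move=> _ [j _ <-]; rewrite /= xs (mulg_morphV (fh t.1).1) fE (mulg_morphV rM').
by rewrite -rs' fs.
Qed.

(** * The topology on Sch *)

Section topologies.
Variable T : Type.

Lemma topology_eq (tau tau' : topology T) : opens tau = opens tau' -> tau = tau'.
Proof.
case: tau tau' => [O OT OI OU] [O' OT' OI' OU'] /= OO'; case: O' / OO' OT' OI' OU' => OT' OI' OU'.
by congr Topology; exact: Prop_irrelevance.
Qed.

(** This determines the open sets from [B] alone. It gives uniqueness of the topology, and later a
    criterion for openness. *)
Lemma basis_opens (tau : topology T) (B : set (set T)) :
  basis (B : set (set (topologized tau))) ->
  opens tau = [set V | forall c, V c -> exists2 W, B W & W c /\ W `<=` V].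
Proof.
move=> [Bo Bn]; apply/seteqP; split=> [V oV c Vc|V BV].
  have : nbhs (c : topologized tau) V by apply: open_nbhs_nbhs; split.
  by move=> /Bn [W [BW Wc] WV]; exists W.
rewrite (_ : V = \bigcup_(W in [set W | B W /\ W `<=` V]) W).
  by apply: opens_bigcup => W [BW _]; exact: Bo.
apply/seteqP; split=> [c /BV[W BW [Wc WV]]|c [W [_ WV] /WV //]].
by exists W.
Qed.

Lemma basis_topology (B : set (set T)) :
  (forall c, exists2 W, B W & W c) ->
  (forall V W c, B V -> B W -> V c -> W c ->
     exists2 X, B X & X c /\ X `<=` V `&` W) ->
  exists! tau : topology T, basis (B : set (set (topologized tau))).
Proof.
move=> Bcover BI.
pose O := [set V | forall c, V c -> exists2 W, B W & W c /\ W `<=` V].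
have OT : O setT by move=> c _; have [W BW Wc] := Bcover c; exists W.
have OI : setI_closed O.
  move=> V W OV OW c [/OV [V' BV' [Vc VV]] /OW [W' BW' [Wc WW]]].
  have [X BX [Xc XVW]] := BI _ _ _ BV' BW' Vc Wc.
  by exists X => //; split=> // d /XVW[/VV ? /WW].
have OU (F : set (set T)) : F `<=` O -> O (\bigcup_(A in F) A).
  move=> FO c [A FA Ac]; have [W BW [Wc WA]] := FO _ FA _ Ac.
  by exists W => //; split=> // d /WA; exists A.
exists (Topology OT OI OU); split; last first.
  by move=> tau /basis_opens tauE; apply: topology_eq; rewrite tauE.
split=> [V BV|c V].
  change (O V).
  by move=> c Vc; exists V => //; split.
rewrite nbhsE => -[W [oW Wc] WV]; change (O W) in oW; have [X BX [Xc XW]] := oW _ Wc.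
by exists X => //; exact: subset_trans WV.
Qed.

End topologies.

Section weak_schur_classes.
Variable p : nat.
Hypothesis p_pr : prime p.
Implicit Types c : Sch p.

Lemma Sch_rep c : exists2 G, weak_schur p G & is_class_of c G.
Proof. by case: c => C [G wG CG]; exists G. Qed.

Lemma is_class_of_iso c G H : is_class_of c G -> is_class_of c H -> sigma_iso G H.
Proof.
rewrite /is_class_of => -> GH; rewrite -[sigma_iso G H]/(iso_class G H) GH.
exact: sigma_iso_refl.
Qed.

Lemma iso_is_class_of c G H : is_class_of c G -> sigma_iso G H -> is_class_of c H.
Proof.
rewrite /is_class_of => -> GH; apply/seteqP; split=> K.
  exact/sigma_iso_trans/sigma_iso_sym.
exact: sigma_iso_trans.
Qed.

Lemma is_class_of_eq c c' G : is_class_of c G -> is_class_of c' G -> c = c'.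
Proof.
by case: c c' => [C CP] [C' CP']; rewrite /is_class_of /= => CG CG'; apply: eq_exist; rewrite CG.
Qed.

(** Isomorphic groups have isomorphic Zassenhaus quotients, so any representative of [c] decides
    membership. *)
Lemma mem_U i G H c : is_class_of c H ->
  U p i G c <-> sigma_iso (quot_zassenhaus p H i) (quot_zassenhaus p G i).
Proof.
move=> cH; split=> [[K cK]|HG]; last by exists H.
exact/sigma_iso_trans/(sigma_iso_zassenhaus p_pr)/(is_class_of_iso cH cK).
Qed.

Lemma U_family_topology :
  exists! tau : topology (Sch p), basis (U_family p : set (set (topologized tau))).
Proof.
apply: basis_topology => [c|_ _ c [i [G [i2 _ ->]]] [j [H [j2 _ ->]]]].
  have [G wG cG] := Sch_rep c; exists (U p 2 G); first by exists 2%N, G.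
  exact/(mem_U _ _ cG)/sigma_iso_refl.
have [K wK cK] := Sch_rep c => /(mem_U _ _ cK) KG /(mem_U _ _ cK) KH.
(* Re-centre at a representative [K] of the common point: being isomorphic to [K] at the larger
   level implies it at both levels. *)
exists (U p (maxn i j) K); first by exists (maxn i j), K; rewrite leq_max i2.
split; first exact/(mem_U _ _ cK)/sigma_iso_refl.
move=> d; have [L _ dL] := Sch_rep d => /(mem_U _ _ dL) LK; split.
  apply/(mem_U _ _ dL)/(sigma_iso_trans _ KG).
  exact: (sigma_iso_zassenhaus_le p_pr (leq_maxl i j)).
apply/(mem_U _ _ dL)/(sigma_iso_trans _ KH).
exact: (sigma_iso_zassenhaus_le p_pr (leq_maxr i j)).
Qed.

Variable tau : topology (Sch p).
Hypothesis tauB : basis (U_family p : set (set (topologized tau))).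

(** An invariant set contains a basic set [U p i G] around each of its points, and its complement is
    invariant as well. Parts (b) and (c) are instances, with i = 2 for the sets defined by d_G. *)
Lemma zassenhaus_invariant_clopen i (P : set (Sch p)) : (2 <= i)%N ->
  (forall c d G H, is_class_of c G -> is_class_of d H ->
     sigma_iso (quot_zassenhaus p G i) (quot_zassenhaus p H i) -> P c -> P d) ->
  clopen (P : set (topologized tau)).
Proof.
move=> i2 Pinv.
have oP (Q : set (Sch p)) :
    (forall c d G H, is_class_of c G -> is_class_of d H ->
       sigma_iso (quot_zassenhaus p G i) (quot_zassenhaus p H i) -> Q c -> Q d) ->
    opens tau Q.
  move=> Qinv; rewrite (basis_opens tauB) => c Qc.
  have [G wG cG] := Sch_rep c; exists (U p i G); first by exists i, G.
  split=> [|d]; first exact/(mem_U _ _ cG)/sigma_iso_refl.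
  have [H _ dH] := Sch_rep d => /(mem_U _ _ dH) HG.
  exact: Qinv cG dH (sigma_iso_sym HG) Qc.
split; first exact: oP.
rewrite -openC; apply: oP => c d G H cG dH GH nPc Pd; apply: nPc.
exact: Pinv dH cG (sigma_iso_sym GH) Pd.
Qed.

Lemma U_clopen i (G : sigmaGroupType) : (2 <= i)%N ->
  clopen (U p i G : set (topologized tau)).
Proof.
move=> i2; apply: (zassenhaus_invariant_clopen i2) => c d K H cK dH KH /(mem_U _ _ cK) KG.
exact/(mem_U _ _ dH)/(sigma_iso_trans (sigma_iso_sym KH)).
Qed.

Lemma dim_H1_zassenhaus2 (G : sigmaGroupType) d :
  dim_H1_is p G d <-> dim_H1_is p (quot_zassenhaus p G 2) d.
Proof.
by apply: (dim_H1_quotient_map p_pr _ (to_quot_quotient_map _)) => x /to_quot_eq1.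
Qed.

Lemma dim_H1_iso (G H : sigmaGroupType) d :
  sigma_iso G H -> dim_H1_is p G d -> dim_H1_is p H d.
Proof.
move=> [f [g [fK gK fh gh fs]]].
apply: (iffLR (dim_H1_quotient_map p_pr d (sigma_quotient_map_iso fK gK fh gh fs) _)) => x fx1.
have -> : x = 1 by rewrite -(fK x) fx1 (mulg_morph1 gh.1).
by have [_ []] := zassenhaus_group p G 2.
Qed.

Lemma dim_H1_iso_zassenhaus2 (G H : sigmaGroupType) d :
  sigma_iso (quot_zassenhaus p G 2) (quot_zassenhaus p H 2) ->
  dim_H1_is p G d -> dim_H1_is p H d.
Proof.
by move=> GH /dim_H1_zassenhaus2 Gd; apply/dim_H1_zassenhaus2; exact: dim_H1_iso GH Gd.
Qed.

Lemma Sch_le_clopen n : clopen (Sch_le p n : set (topologized tau)).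
Proof.
apply: (@zassenhaus_invariant_clopen 2) => // c d G H cG dH GH [K [e [cK Ke en]]].
exists H, e; split=> //; apply: dim_H1_iso_zassenhaus2 GH _.
exact: dim_H1_iso (is_class_of_iso cK cG) Ke.
Qed.

Lemma Sch_eq_clopen n : clopen (Sch_eq p n : set (topologized tau)).
Proof.
apply: (@zassenhaus_invariant_clopen 2) => // c d G H cG dH GH [K cK Kn].
exists H => //; apply: dim_H1_iso_zassenhaus2 GH _.
exact: dim_H1_iso (is_class_of_iso cK cG) Kn.
Qed.

(** Distinct classes differ modulo some D_i, and the clopen set [U p i G] then separates them. Both
    claims of (d) follow from this separation by clopen sets. *)
Lemma Sch_zero_dimensional : zero_dimensional (topologized tau).
Proof.
move=> c d cd; have [G wG cG] := Sch_rep c; have [H wH dH] := Sch_rep d.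
have [i i2 nGH] : exists2 i, (2 <= i)%N &
    ~ sigma_iso (quot_zassenhaus p H i) (quot_zassenhaus p G i).
  apply: contrapT => nex; case/eqP: cd; apply: (is_class_of_eq cG).
  apply: (iso_is_class_of dH); apply: (zassenhaus_quotients_determine p_pr wH wG) => i i2.
  by apply: contrapT => nHG; apply: nex; exists i.
exists (U p i G); split; first exact: U_clopen.
  exact/(mem_U _ _ cG)/sigma_iso_refl.
by move=> /(mem_U _ _ dH).
Qed.

End weak_schur_classes.

Theorem proposition8p2 (p : nat) (p_prime : prime p) (p_gt2 : (2 < p)%N) :
  (exists! tau : topology (Sch p),
     basis (U_family p : set (set (topologized tau)))) /\
  (forall tau : topology (Sch p),
     basis (U_family p : set (set (topologized tau))) ->
     [/\ forall (i : nat) (G : sigmaGroupType), (2 <= i)%N -> weak_schur p G ->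
           clopen (U p i G : set (topologized tau)),
         forall n : nat, clopen (Sch_le p n : set (topologized tau)) /\
                         clopen (Sch_eq p n : set (topologized tau)),
         hausdorff_space (topologized tau) &
         totally_disconnected [set: topologized tau]]).
Proof.
split; first exact: U_family_topology.
move=> tau tauB; have z := Sch_zero_dimensional p_prime tauB; split.
- by move=> i G i2 _; exact: (U_clopen p_prime tauB).
- by move=> n; split; [exact: (Sch_le_clopen p_prime tauB)|exact: (Sch_eq_clopen p_prime tauB)].
- exact: zero_dimensional_hausdorff.
- exact: zero_dimension_totally_disconnected.
Qed.
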